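(* Let $\varepsilon>0$. Let $q$ be an integral ternary quadratic form with integral matrix $M$. Let $\Delta=|\det(M)|$ and assume that $\Delta\neq 0$. Write $\Delta_0$ for the highest common factor of the $2\times 2$ minors of $M$, and let $R_1,R_2,R_3$ be positive real numbers. Then the number of primitive integer solutions $\mathbf{x}\in\mathbb{Z}^3$ of $q(\mathbf{x})=0$ in the box $|x_i|\leq R_i$ $(1\leq i\leq 3)$ is $$\ll_{\varepsilon}\left\{1+\left(\frac{R_1R_2R_3\Delta_0^2}{\Delta}\right)^{1/3+\varepsilon}\right\}d_3(\Delta),$$ where the implied constant depends only on $\varepsilon$.
   Context: The matrix $M$ of $q$ is the symmetric matrix with $q(\mathbf{x})=\mathbf{x}^{T}M\mathbf{x}$. An integer vector is primitive if the greatest common divisor of its entries is $1$. For a positive integer $m$, $d_3(m)$ denotes the number of ordered triples of positive integers $(a,b,c)$ with $abc=m$. *)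

(* Defs.v *)
From HB Require Import structures.
From mathcomp Require Import all_boot all_order all_algebra.
From mathcomp Require Import finmap.
From mathcomp Require Import zify.
From mathcomp Require Import all_classical all_reals all_analysis.

Set Implicit Arguments.
Unset Strict Implicit.
Unset Printing Implicit Defensive.

Import Order.TTheory GRing.Theory Num.Theory.

Local Open Scope ring_scope.
Local Open Scope classical_set_scope.

Definition is_matrix_of (q : 'cV[int]_3 -> int) (M : 'M[int]_3) : Prop :=
  M^T = M /\ forall x : 'cV[int]_3, q x = (x^T *m M *m x) 0 0.

(* The 2 x 2 minors of a 3 x 3 matrix are obtained by deleting one row and one
   column; [gcdn] over absolute values makes the result nonnegative. *)
Definition gcd_minors2 (M : 'M[int]_3) : nat :=
  \big[gcdn/0%N]_(i < 3) \big[gcdn/0%N]_(j < 3)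
    `|\det (row' i (col' j M))|%N.

Definition primitive (x : 'cV[int]_3) : bool :=
  (\big[gcdn/0%N]_(i < 3) `|x i ord0|%N) == 1%N.

(* Restricting a, b, c to be at most m loses nothing: positive factors of a
   positive m satisfy this. *)
Definition d3 (m : nat) : nat :=
  #|[set t : 'I_m.+1 * 'I_m.+1 * 'I_m.+1 |
      [&& (0 < t.1.1)%N, (0 < t.1.2)%N, (0 < t.2)%N
        & (t.1.1 * t.1.2 * t.2)%N == m]]%SET|.

Definition primitive_zeros (R : realType) (q : 'cV[int]_3 -> int)
    (B : 'I_3 -> R) : set 'cV[int]_3 :=
  [set x | [/\ primitive x, q x = 0 & forall i, `|(x i ord0)%:~R| <= B i]].

(* This makes [fset_set (primitive_zeros q B)] the set itself rather than the
   default value of [fset_set] on infinite sets. *)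
Lemma finite_primitive_zeros (R : realType) (q : 'cV[int]_3 -> int)
  (B : 'I_3 -> R) : finite_set (primitive_zeros q B).
Proof.
pose N := (\max_(i < 3) (Num.truncn (B i)).+1)%N.
pose f (g : {ffun 'I_3 -> 'I_(N + N).+1}) : 'cV[int]_3 :=
  \col_i ((g i : nat)%:Z - N%:Z).
apply: (@sub_finite_set _ _ (f @` setT)); last first.
  by apply: finite_image; exact: finite_finset.
move=> x [_ _ hx].
have hN i : (`|x i ord0| <= N)%N.
  apply: leq_trans (leq_bigmax i).
  rewrite -(ler_nat R) natr_absz intr_norm.
  exact: le_trans (hx i) (ltW (truncnS_gt _)).
exists [ffun i => inord (absz (x i ord0 + N%:Z))] => //.
apply/colP => i; have := hN i.
rewrite mxE ffunE [x i 0]/(x i ord0).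
move: (x i ord0) (N) => y n hy.
by rewrite inordK; lia.
Qed.

(* Main.v *)
(** Two ideas combine.  If [p] divides [Delta0], then [M] has rank at most one
    modulo [p], so the zeros lie in a sublattice of index [p] on which [q] is
    divisible by [p]; passing to it divides [Delta] by [p] and does not increase
    [Delta0].  So one may take [Delta0 = 1].  A zero [x0], completed to a basis,
    then brings [q] to the shape [2 g t y + a y^2 + 2 b y z + c z^2] with
    [Delta = g^2 |c|] and [gcd(g, b^2 - a c) = 1], and projection from [x0]
    parametrises the conic: with [(y, z) = d (y1, z1)] and [s = 2 g y1 / d], one
    has [s t = - Q (y1, z1)], where [Q = a y^2 + 2 b y z + c z^2].  The
    point [(y1, z1)] determines a square root of [b^2 - a c] modulo [s]; sort the
    zeros by [s] and by the residues of that root modulo [4] and the primes of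
    [gcd(s, g)].  There are [O(d3 Delta)] classes, and in each class [s] divides
    twice every wedge [y1 z1' - z1 y1'].  A determinant of three zeros of a class
    is [4 Delta / s^3] times the product of three wedges and is at most
    [6 R1 R2 R3]; by a planar packing argument such a class has
    [O(1 + (R1 R2 R3 / Delta)^(1/3))] elements. *)

Require Import Defs.
From HB Require Import structures.
From mathcomp Require Import all_boot all_order all_algebra.
From mathcomp Require Import finmap.
From mathcomp Require Import zify ring lra.
From mathcomp Require Import all_classical all_reals all_analysis.

Set Implicit Arguments.
Unset Strict Implicit.
Unset Printing Implicit Defensive.

Import Order.TTheory GRing.Theory Num.Theory.

Local Open Scope ring_scope.

(** * Divisor triples *)

(** A pair with product dividing [n] extends uniquely to a factorisation of [n] into three factors.
    The classes of zeros are labelled by such pairs, whence [d3] in the bound. *)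
Lemma size_pairs_le_d3 (n : nat) (S : seq (nat * nat)) :
  (0 < n)%N -> uniq S -> {in S, forall x, x.1 * x.2 %| n}%N ->
  (size S <= d3 n)%N.
Proof.
move=> n0 uS hS.
pose f (x : nat * nat) : 'I_n.+1 * 'I_n.+1 * 'I_n.+1 :=
  (inord x.1, inord x.2, inord (n %/ (x.1 * x.2))).
have hle x : x \in S -> [/\ 0 < x.1, 0 < x.2, x.1 <= n & x.2 <= n]%N.
  move=> /hS h; have := dvdn_gt0 n0 h; rewrite muln_gt0 => /andP[a b].
  split=> //; apply: (dvdn_leq n0); apply: dvdn_trans h.
    exact: dvdn_mulr.
  exact: dvdn_mull.
have inj : {in S &, injective f}.
  move=> [a b] [c d] /hle[_ _ /= ha hb] /hle[_ _ /= hc hd] [].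
  move=> /(congr1 val)/=; rewrite !inordK // => ->.
  by move=> /(congr1 val)/=; rewrite !inordK // => ->.
rewrite -(size_map f) /d3 cardE; apply: uniq_leq_size.
  by rewrite map_inj_in_uniq.
move=> _ /mapP[x xS ->]; rewrite mem_enum inE.
have [a b c d] := hle _ xS; have h := hS _ xS.
have e : (n %/ (x.1 * x.2) < n.+1)%N by rewrite ltnS leq_div.
have ab0 : (0 < x.1 * x.2)%N by rewrite muln_gt0 a.
have q0 : (0 < n %/ (x.1 * x.2))%N by rewrite divn_gt0 // dvdn_leq.
have [-> -> ->] : [/\ (f x).1.1 = x.1 :> nat, (f x).1.2 = x.2 :> nat
    & (f x).2 = (n %/ (x.1 * x.2))%N :> nat] by split; rewrite /= inordK.
by rewrite a b q0 mulnC divnK /=.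
Qed.

Lemma d3_dvd_le (m n : nat) : (0 < n)%N -> (m %| n)%N -> (d3 m <= d3 n)%N.
Proof.
move=> n0 mn; have m0 := dvdn_gt0 n0 mn.
set A := [set t : 'I_m.+1 * 'I_m.+1 * 'I_m.+1 |
  [&& (0 < t.1.1)%N, (0 < t.1.2)%N, (0 < t.2)%N
    & (t.1.1 * t.1.2 * t.2)%N == m]]%SET.
pose f (t : 'I_m.+1 * 'I_m.+1 * 'I_m.+1) := (t.1.1 : nat, t.1.2 : nat).
rewrite {1}/d3 -/A cardE -(size_map f); apply: size_pairs_le_d3 => //.
  rewrite map_inj_in_uniq ?enum_uniq //.
  move=> [[a b] c] [[a' b'] c'].
  rewrite !mem_enum !inE /= => /and4P[a0 b0 _ /eqP h] /and4P[_ _ _ /eqP h'].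
  move=> [/val_inj ea /val_inj eb]; subst a' b'; congr (_, _); apply: val_inj => /=.
  by apply/eqP; rewrite -(@eqn_pmul2l (a * b)) ?muln_gt0 ?a0 // h h'.
move=> _ /mapP[[[a b] c] hin ->]; move: hin.
rewrite mem_enum inE /= => /and4P[a0 b0 _ /eqP h].
by apply: dvdn_trans mn; apply/dvdnP; exists c; rewrite -[LHS]h mulnC.
Qed.

Lemma d3_gt0 (n : nat) : (0 < n)%N -> (0 < d3 n)%N.
Proof.
move=> n0; apply: (@size_pairs_le_d3 n [:: (1, 1)]%N) => // x.
by rewrite inE => /eqP ->.
Qed.

(** * Packing in the plane *)

Lemma size_le_fibers (T L : eqType) (f : T -> L) (ls : seq L) (n : nat)
    (X : seq T) :
  {in X, forall x, f x \in ls} ->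
  (forall l, size [seq x <- X | f x == l] <= n)%N ->
  (size X <= size ls * n)%N.
Proof.
elim: ls X => [|l ls IH] X hX hn.
  by case: X hX {hn} => // x X /(_ x (mem_head _ _)).
rewrite -(count_predC (fun x => f x == l) X) /= mulSn -!size_filter.
apply: leq_add (hn l) _; apply: IH => [x|l'].
  rewrite mem_filter => /andP[/= fx /hX]; rewrite inE.
  by rewrite (negPf fx).
rewrite -filter_predI; apply: leq_trans (hn l').
rewrite !size_filter; apply: sub_count => x /=.
by case/andP.
Qed.

Lemma ex_max_seq (R : realDomainType) (T : eqType) (F : T -> R) (s : seq T)
    (x0 : T) :
  x0 \in s -> exists2 x, x \in s & {in s, forall y, F y <= F x}.
Proof.
elim: s x0 => // y [|z s] IH x0 _.
  by exists y; rewrite ?mem_head // => u; rewrite inE => /eqP ->.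
have [x xs hx] := IH z (mem_head _ _).
have [yx|xy] := leP (F y) (F x).
  exists x; first by rewrite inE xs orbT.
  by move=> u; rewrite inE => /predU1P[->//|/hx].
exists y; first exact: mem_head.
move=> u; rewrite inE => /predU1P[->//|/hx h]; exact: le_trans h (ltW xy).
Qed.

Definition wedge (R : pzRingType) (u v : R * R) : R := u.1 * v.2 - u.2 * v.1.

(* With [e] the distance to be bounded and [r = D / (k * m)], one has [e >= r^-1]
   and [e ^+ 2 >= r], so [e ^+ 3 >= 1]. *)
Lemma sector_gap (R : realType) (k m D a b a' b' : R) :
  1 <= k -> 0 < m -> 0 < D ->
  0 < a <= D -> 0 <= b <= a -> 0 < a' <= D -> 0 <= b' <= a' ->
  D * m <= `|b' * a - b * a'| ->
  D * (a * b) <= (k * m) ^+ 3 -> D * (a' * b') <= (k * m) ^+ 3 ->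
  1 <= `|2 * k * Num.sqrt (b' / a') - 2 * k * Num.sqrt (b / a)|.
Proof.
move=> k1 m0 D0.
wlog: a b a' b' / b / a <= b' / a' => [th|le_t].
  move=> ha hb ha' hb' h1 h2 h3.
  have [l|l] := lerP (b / a) (b' / a'); first exact: th.
  by rewrite distrC; apply: th => //; [exact: ltW|rewrite distrC].
move=> /andP[a0 aD] /andP[b0 ba] /andP[a0' aD'] /andP[b0' ba'] hD hab hab'.
set t := b / a in le_t *; set t' := b' / a' in le_t *.
have ebt : b = t * a by rewrite /t divfK ?gt_eqF.
have ebt' : b' = t' * a' by rewrite /t' divfK ?gt_eqF.
have t0 : 0 <= t by rewrite divr_ge0 // ltW.
have t0' : 0 <= t' by rewrite divr_ge0 // ltW.
have t1' : t' <= 1 by rewrite ler_pdivrMr // mul1r.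
set u := Num.sqrt t; set u' := Num.sqrt t'.
have u0 : 0 <= u by exact: sqrtr_ge0.
have u0' : 0 <= u' by exact: sqrtr_ge0.
have eu : t = u ^+ 2 by rewrite sqr_sqrtr.
have eu' : t' = u' ^+ 2 by rewrite sqr_sqrtr.
have uu' : u <= u' by rewrite ler_wsqrtr.
have u1' : u' <= 1 by rewrite -sqrtr1 ler_wsqrtr.
rewrite -mulrBr ger0_norm ?mulr_ge0 ?subr_ge0 //; last by lra.
have hgap : D * m <= (t' - t) * (a * a').
  apply: le_trans hD _; rewrite ebt ebt'.
  have -> : t' * a' * a - t * a * a' = (t' - t) * (a * a') by ring.
  by rewrite ger0_norm // mulr_ge0 ?subr_ge0 // mulr_ge0 // ltW.
set e := 2 * k * _.
have k0 : 0 < k by lra.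
have km0 : 0 < k * m by exact: mulr_gt0.
have e0 : 0 <= e by rewrite mulr_ge0 ?subr_ge0 //; lra.
have du : t' - t = (u' - u) * (u' + u) by rewrite eu eu'; ring.
have hgap1 : m <= (t' - t) * a'.
  rewrite -(ler_pM2l D0); apply: le_trans hgap _.
  have -> : D * ((t' - t) * a') = (t' - t) * (D * a') by ring.
  by rewrite ler_wpM2l ?subr_ge0 // ler_wpM2r // ltW.
have hgap2 : m <= (t' - t) * D.
  by apply: le_trans hgap1 _; rewrite ler_wpM2l ?subr_ge0.
have e1 : k * m <= e * D.
  have : (t' - t) * D <= (u' - u) * 2 * D.
    rewrite du (ler_wpM2r (ltW D0)) // ler_wpM2l ?subr_ge0 //; lra.
  move=> /(le_trans hgap2) h; rewrite /e.
  have -> : 2 * k * (u' - u) * D = k * ((u' - u) * 2 * D) by ring.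
  by rewrite ler_wpM2l // ltW.
have h3 : m <= (u' - u) * (2 * u') * a'.
  apply: le_trans hgap1 _; rewrite du (ler_wpM2r (ltW a0')) // ler_wpM2l ?subr_ge0 //.
  lra.
(* Squaring [h3] produces [u' ^+ 2 * a' ^+ 2 = a' * b'], which the cubic hypothesis on the vector of
   larger slope bounds. *)
have e2 : D <= e ^+ 2 * (k * m).
  have m2 : m ^+ 2 <= ((u' - u) * (2 * u') * a') ^+ 2.
    by rewrite ler_sqr // nnegrE; [exact: ltW|exact: le_trans (ltW m0) h3].
  have : D * m ^+ 2 <= (2 * (u' - u)) ^+ 2 * (k * m) ^+ 3.
    apply: (@le_trans _ _ ((2 * (u' - u)) ^+ 2 * (D * (a' * b')))).
      have -> : (2 * (u' - u)) ^+ 2 * (D * (a' * b')) =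
        D * ((u' - u) * (2 * u') * a') ^+ 2 by rewrite ebt' eu'; ring.
      by rewrite (ler_wpM2l (ltW D0)).
    by rewrite ler_wpM2l // sqr_ge0.
  have -> : (2 * (u' - u)) ^+ 2 * (k * m) ^+ 3 = e ^+ 2 * (k * m) * m ^+ 2.
    by rewrite /e; ring.
  by rewrite ler_pM2r // exprn_gt0.
have : 1 <= e ^+ 3.
  rewrite -(ler_pM2l km0) mulr1.
  have -> : k * m * e ^+ 3 = (e ^+ 2 * (k * m)) * e by ring.
  by apply: le_trans e1 _; rewrite mulrC ler_wpM2r.
by rewrite -[1 in X in X -> _](expr1n _ 3) ler_pXn2r // nnegrE.
Qed.

Lemma truncn_eq_dist (R : realType) (x y : R) :
  0 <= x -> 0 <= y -> Num.truncn x = Num.truncn y -> `|x - y| < 1.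
Proof.
move=> x0 y0 e; have /andP[x1 x2] := trunc_itv x0.
have /andP[y1 y2] := trunc_itv y0.
rewrite -e in y1 y2; move: x2 y2; rewrite -natr1 => x2 y2.
by rewrite ltr_norml; apply/andP; split; lra.
Qed.

Lemma dist_same_sign (R : realDomainType) (x y : R) :
  0 <= x * y -> `|x - y| = `| `|x| - `|y| |.
Proof.
case: (ler0P x) => x0; case: (ler0P y) => y0 xy.
- by rewrite -opprD normrN.
- have -> : x = 0 by apply/eqP; rewrite eq_le x0 -(pmulr_lge0 _ y0).
  by rewrite !oppr0 !add0r.
- have -> : y = 0 by apply/eqP; rewrite eq_le y0 -(pmulr_rge0 _ x0).
  by rewrite !oppr0 !addr0.
- by [].
Qed.

(* Normalise by a pair [p, q] with the largest wedge [D], so that the other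
   vectors have coordinates [w q x / D] and [w p x / D] of size at most 1; the
   square root of the slope then separates the vectors of a sector. *)
Lemma planar_count (R : realType) (T : eqType) (X : seq T) (v : T -> R * R)
    (k m : R) :
  1 <= k -> 0 < m -> uniq X ->
  {in X &, forall x y, x != y -> m <= `|wedge (v x) (v y)|} ->
  {in X & &, forall x y z,
     `|wedge (v x) (v y)| * `|wedge (v y) (v z)| * `|wedge (v x) (v z)|
       <= (k * m) ^+ 3} ->
  (size X)%:R <= 4 * (2 * k + 1).
Proof.
move=> k1 m0 uX hm hk; pose w x y := wedge (v x) (v y).
case eX : X => [|x0 [|x1 Y]]; [by rewrite /=; lra|by rewrite /=; lra|].
have x0X : x0 \in X by rewrite eX mem_head.
have x1X : x1 \in X by rewrite eX !inE eqxx orbT.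
have x01 : x0 != x1.
  by move: uX; rewrite eX /= inE negb_or => /andP[/andP[]].
rewrite -eX; clear Y eX.
have [[p q] /allpairsP[[p' q'] [/= pX qX [ep eq]]] hpq] :
    exists2 z, z \in [seq (x, y) | x <- X, y <- X] &
      {in [seq (x, y) | x <- X, y <- X], forall y, `|w y.1 y.2| <= `|w z.1 z.2|}.
  apply: (@ex_max_seq _ _ (fun z => `|w z.1 z.2|) _ (x0, x1)).
  by apply/allpairsP; exists (x0, x1).
subst p' q'; set D := `|w p q|.
have hD x y : x \in X -> y \in X -> `|w x y| <= D.
  by move=> xX yX; apply: (hpq (x, y)); apply/allpairsP; exists (x, y).
have mD : m <= D by apply: le_trans (hD _ _ x0X x1X); exact: hm.
have D0 : 0 < D by apply: lt_le_trans mD.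
have wxx x : w x x = 0 by rewrite /w /wedge; ring.
have wC x y : w x y = - w y x by rewrite /w /wedge; ring.
have pq : p != q.
  by apply/eqP => e; move: D0; rewrite /D e wxx normr0 ltxx.
pose a x := w q x; pose b x := w p x.
(* The Plucker relation: up to the factor [w p q], wedges can be computed in the coordinates [a] and
   [b]. *)
have abP x y : w p q * w x y = b x * a y - b y * a x.
  by rewrite /a /b /w /wedge; ring.
have aD x : x \in X -> `|a x| <= D by move=> xX; exact: hD.
have bD x : x \in X -> `|b x| <= D by move=> xX; exact: hD.
have ab0 x : x \in X -> (0 < `|a x|) || (0 < `|b x|).
  move=> xX; have [e|ne] := eqVneq x p.
    by rewrite e /a wC normrN -/D D0.
  by rewrite (lt_le_trans m0 (hm _ _ pX xX _)) ?orbT // eq_sym.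
have abk x : x \in X -> D * (`|a x| * `|b x|) <= (k * m) ^+ 3.
  by move=> xX; rewrite mulrA; exact: hk.
have gap x y : x \in X -> y \in X -> x != y -> D * m <= `|b x * a y - b y * a x|.
  by move=> xX yX xy; rewrite -abP normrM ler_wpM2l ?normr_ge0 //; exact: hm.
(* The slope is inverted when it exceeds 1, so that [c x] lies between 0 and [2 * k]. *)
pose c x := 2 * k * Num.sqrt (if `|b x| <= `|a x| then `|b x| / `|a x|
                               else `|a x| / `|b x|).
(* The larger coordinate and the sign of the slope give four sectors; inside one, values of [c]
   differ by at least 1, so their integer parts are distinct. *)
pose code x := (`|b x| <= `|a x|, 0 <= a x * b x, Num.truncn (c x)).
have c0 x : 0 <= c x by rewrite mulr_ge0 ?sqrtr_ge0 //; lra.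
have sgn x y : (0 <= a x * b x) = (0 <= a y * b y) ->
    0 <= (b x * a y) * (b y * a x).
  have -> : (b x * a y) * (b y * a x) = (a x * b x) * (a y * b y) by ring.
  have [h /esym h'|h /esym/negbT] := lerP 0 (a x * b x); first exact: mulr_ge0.
  by rewrite -ltNge => h'; rewrite mulr_le0 // ltW.
have inj : {in X &, injective code}.
  move=> x y xX yX [e1 e2 e3]; apply/eqP; apply: contraT => xy.
  have := truncn_eq_dist (c0 x) (c0 y) e3; rewrite ltNge => /negP[].
  have := gap _ _ xX yX xy; rewrite (dist_same_sign (sgn _ _ e2)) !normrM => hg.
  have ax := ab0 _ xX; have ay := ab0 _ yX; rewrite /c -e1.
  move: e1; have [bax /esym bay|abx /esym/negbT] := lerP `|b x| `|a x|.
    apply: (@sector_gap R k m D) => //; rewrite ?aD ?andbT ?normr_ge0 //.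
    - by case/orP: ay => // /lt_le_trans; apply.
    - by case/orP: ax => // /lt_le_trans; apply.
    - exact: abk.
    - exact: abk.
  rewrite -ltNge => aby.
  apply: (@sector_gap R k m D) => //; rewrite ?bD ?andbT ?normr_ge0 ?(ltW abx) ?(ltW aby) //.
  - by case/orP: ay => // /lt_trans; apply.
  - by case/orP: ax => // /lt_trans; apply.
  - by rewrite distrC [ `|a x| * _]mulrC [ `|a y| * _]mulrC.
  - by rewrite (mulrC `|b y|); exact: abk.
  - by rewrite (mulrC `|b x|); exact: abk.
pose n := Num.truncn (2 * k).
have hsz : (size X <= 4 * n.+1)%N.
  rewrite -(size_map code).
  have -> : (4 * n.+1)%N =
      size [seq (z, i) | z <- [seq (u, u') | u <- [:: true; false],
                                 u' <- [:: true; false]], i <- iota 0 n.+1].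
    by rewrite size_allpairs size_iota.
  apply: uniq_leq_size; first by rewrite map_inj_in_uniq.
  move=> _ /mapP[x xX ->]; apply/allpairsP.
  exists ((code x).1, (code x).2); split => //; last first.
    rewrite mem_iota add0n ltnS leq0n /n; apply: le_truncn.
    rewrite -[leRHS]mulr1 ler_wpM2l //; first by lra.
    rewrite -sqrtr1 ler_wsqrtr //.
    have := ab0 _ xX; case: ifP => [h|/negbT]; rewrite -?ltNge => o.
      by rewrite ler_pdivrMr ?mul1r //; case/orP: o => // /lt_le_trans; apply.
    by move=> o'; rewrite ler_pdivrMr ?mul1r ?(ltW o) //; case/orP: o' => // /lt_trans; apply.
  by rewrite /code; case: (`|b x| <= _); case: (0 <= _).
have hn : n%:R <= 2 * k by rewrite truncn_le; lra.
have : (size X)%:R <= (4 * n.+1)%:R :> R by rewrite ler_nat.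
rewrite natrM -natr1; lra.
Qed.

(** * Isotropic ternary forms *)

(* The zero [(t, y, z)] of [2 g t y + a y ^+ 2 + 2 b y z + c z ^+ 2] is the
   point [(y1 : z1)] of the projective line, through the projection from
   [(1, 0, 0)]; [lam] is the eigenvalue modulo [s] attached to the isotropic
   vector [(y1, z1)] of the binary form [(a, 2 b, c)]. *)
Record conic_param (g a b c t y z s y1 z1 lam : int) : Prop := ConicParam {
  cp_s : 0 < s;
  cp_y : 0 < y1;
  cp_coprime : coprimez y1 z1;
  cp_st : s * t = - (a * y1 ^+ 2 + 2 * b * y1 * z1 + c * z1 ^+ 2);
  cp_sy : s * y = 2 * g * y1 ^+ 2;
  cp_sz : s * z = 2 * g * y1 * z1;
  cp_dvd_gc : (s %| 2 * (g * c))%Z;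
  cp_dvd_gy : (s %| 2 * g * y1)%Z;
  cp_dvd_lamy : (s %| lam * y1 - (b * y1 + c * z1))%Z;
  cp_dvd_lamz : (s %| lam * z1 + (a * y1 + b * z1))%Z;
  cp_dvd_lam2 : (s %| lam ^+ 2 - (b ^+ 2 - a * c))%Z
}.

(** Primitivity makes [d = gcdz y z] coprime to [t], so the equation forces [d] to divide
    [2 * g * y1]; the quotient is [s]. As [Q] vanishes at [(y1, z1)] modulo [s], the matrix with
    rows [(b, c)] and [(-a, -b)] maps [(y1, z1)] to a multiple of itself modulo [s]; the multiplier
    [lam] is read off with Bezout coefficients. *)
Lemma ex_conic_param (g a b c t y z : int) :
  0 < g -> 0 < y -> gcdz t (gcdz y z) = 1 ->
  2 * g * t * y + (a * y ^+ 2 + 2 * b * y * z + c * z ^+ 2) = 0 ->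
  exists s y1 z1 lam, conic_param g a b c t y z s y1 z1 lam.
Proof.
move=> g0 y0 co eq0; pose d := gcdz y z.
have d0 : d != 0 by rewrite gcdz_eq0 negb_and gt_eqF.
have dp : 0 < d by rewrite lt0r d0.
have /dvdzP[y1 ey] : (d %| y)%Z by exact: dvdz_gcdl.
have /dvdzP[z1 ez] : (d %| z)%Z by exact: dvdz_gcdr.
have y1p : 0 < y1 by move: y0; rewrite ey pmulr_lgt0.
have co1 : coprimez y1 z1.
  rewrite /coprimez -(inj_eq (mulIf d0)) mul1r.
  have := mulz_gcdl y1 z1 d; rewrite -ey -ez -/d => h.
  by apply/eqP; rewrite -[RHS]h gtz0_abs.
set Q := a * y1 ^+ 2 + 2 * b * y1 * z1 + c * z1 ^+ 2.
have eq1 : 2 * g * t * y1 = - (d * Q).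
  apply: (mulIf d0); apply/eqP; rewrite -subr_eq0; apply/eqP.
  by rewrite -[RHS]eq0 ey ez /Q; ring.
(* [y1] divides [d * Q], hence [d * c * z1 ^+ 2], and it is coprime to [z1]. The quotient [e] later
   witnesses that [s] divides [2 * (g * c)]. *)
have /dvdzP[e hdc] : (y1 %| d * c)%Z.
  rewrite -(Gauss_dvdzl _ (_ : coprimez y1 (z1 ^+ 2))); last exact: coprimezXr.
  apply/dvdzP; exists (- (2 * g * t + d * (a * y1 + 2 * b * z1))).
  have -> : d * c * z1 ^+ 2 = d * Q - d * (a * y1 ^+ 2 + 2 * b * y1 * z1).
    by rewrite /Q; ring.
  have -> : d * Q = - (2 * g * t * y1) by rewrite eq1 opprK.
  by ring.
have /dvdzP[s hs] : (d %| 2 * g * y1)%Z.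
  rewrite -(@Gauss_dvdzr _ t); last by rewrite /coprimez gcdzC co.
  by apply/dvdzP; exists (- Q); rewrite -[RHS]/(- Q * d); move: eq1; lia.
have sp : 0 < s.
  by rewrite -(pmulr_lgt0 _ dp) -hs !mulr_gt0.
have st : s * t = - Q.
  apply: (mulIf d0).
  have -> : s * t * d = 2 * g * t * y1 by rewrite -mulrA [t * d]mulrC mulrA -hs; ring.
  by rewrite eq1; ring.
have /coprimezP[[u v] /= uv] := co1.
have E1 : (u * (b * y1 + c * z1) - v * (a * y1 + b * z1)) * y1
    - (b * y1 + c * z1) = v * (s * t).
  have -> : v * (s * t) = (u * y1 + v * z1 - 1) * (b * y1 + c * z1) - v * Q.
    by rewrite st uv; ring.
  by rewrite /Q; ring.
have E2 : (u * (b * y1 + c * z1) - v * (a * y1 + b * z1)) * z1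
    + (a * y1 + b * z1) = - (u * (s * t)).
  have -> : - (u * (s * t)) = (1 - (u * y1 + v * z1)) * (a * y1 + b * z1) + u * Q.
    by rewrite st uv; ring.
  by rewrite /Q; ring.
exists s, y1, z1, (u * (b * y1 + c * z1) - v * (a * y1 + b * z1)).
move: E1 E2; set lam := u * _ - _ => E1 E2; split => //.
- by rewrite ey mulrCA -hs; ring.
- by rewrite ez mulrCA -hs; ring.
- have dy0 : d * y1 != 0 by rewrite mulf_neq0 ?gt_eqF.
  apply/dvdzP; exists e; apply: (mulIf dy0).
  have -> : 2 * (g * c) * (d * y1) = (2 * g * y1) * (d * c) by ring.
  by rewrite hs hdc; ring.
- by apply/dvdzP; exists d; rewrite hs mulrC.
- by rewrite E1 dvdz_mull // dvdz_mulr.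
- by rewrite E2 rpredN dvdz_mull // dvdz_mulr.
(* The matrix has square [b ^+ 2 - a * c], so the eigenvector relations give the left side times
   [y1] and times [z1]; Bezout combines the two. *)
have -> : lam ^+ 2 - (b ^+ 2 - a * c) =
    (u * ((b + lam) * v - c * u) - v * (a * v + (lam - b) * u)) * t * s.
  rewrite -[LHS]mulr1 -uv.
  have -> : (lam ^+ 2 - (b ^+ 2 - a * c)) * (u * y1 + v * z1) =
    u * ((b + lam) * (lam * y1 - (b * y1 + c * z1)) + c * (lam * z1 + (a * y1 + b * z1)))
    + v * ((lam - b) * (lam * z1 + (a * y1 + b * z1)) - a * (lam * y1 - (b * y1 + c * z1))).
    by ring.
  by rewrite E1 E2; ring.
exact: dvdz_mull.
Qed.

(** The matrix with rows [(b, c)] and [(-a, -b)] has trace 0; acting on each factor of the wedge of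
    two eigenvectors in turn and adding, it gives 0 on one hand and [lam + lam'] times the wedge on
    the other. *)
Lemma conic_param_pair (g a b c t y z t' y' z' s y1 z1 lam y1' z1' lam' : int) :
  conic_param g a b c t y z s y1 z1 lam ->
  conic_param g a b c t' y' z' s y1' z1' lam' ->
  (s %| 2 * g * (y1 * z1' - z1 * y1'))%Z /\
  (s %| (lam + lam') * (y1 * z1' - z1 * y1'))%Z.
Proof.
move=> [_ _ _ _ _ _ _ h1 h2 h3 _] [_ _ _ _ _ _ _ h1' h2' h3' _]; split.
  have -> : 2 * g * (y1 * z1' - z1 * y1') = (2 * g * y1) * z1' - (2 * g * y1') * z1.
    by ring.
  by rewrite rpredB // dvdz_mulr.
have -> : (lam + lam') * (y1 * z1' - z1 * y1') =
  (lam * y1 - (b * y1 + c * z1)) * z1' - (lam * z1 + (a * y1 + b * z1)) * y1'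
  - (lam' * y1' - (b * y1' + c * z1')) * z1 + (lam' * z1' + (a * y1' + b * z1')) * y1.
  by ring.
by rewrite rpredD ?rpredB // dvdz_mulr.
Qed.

(** Coprime pairs with zero wedge agree up to sign, hence are equal as [y1] and [y1'] are positive;
    together with [s] the pair fixes the zero. *)
Lemma conic_param_inj (g a b c t y z t' y' z' s y1 z1 lam lam' y1' z1' : int) :
  conic_param g a b c t y z s y1 z1 lam ->
  conic_param g a b c t' y' z' s y1' z1' lam' ->
  y1 * z1' - z1 * y1' = 0 -> (t, y, z) = (t', y', z').
Proof.
move=> [s0 y0 co st sy sz _ _ _ _ _] [_ y0' co' st' sy' sz' _ _ _ _ _] /eqP.
rewrite subr_eq0 => /eqP e.
have d1 : (y1 %| y1')%Z.
  rewrite -(Gauss_dvdzr _ co) -e; exact: dvdz_mulr.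
have d2 : (y1' %| y1)%Z.
  rewrite -(Gauss_dvdzl _ co') e; exact: dvdz_mull.
have ey : y1 = y1'.
  by move: d1 d2 y0 y0'; rewrite !dvdzE; case: y1 {e co st sy sz} => // n;
    case: y1' {co' st' sy' sz'} => // m /= nm mn _ _; congr Posz;
    apply/eqP; rewrite eqn_dvd nm.
have ez : z1 = z1'.
  by apply: (@mulfI _ y1); rewrite ?gt_eqF // e -ey mulrC.
subst y1' z1'; have s1 : s != 0 by rewrite gt_eqF.
by congr (_, _, _); apply: (mulfI s1); rewrite ?st ?st' ?sy ?sy' ?sz ?sz'.
Qed.

(** * Classes of zeros with a common label *)

Lemma dvdn2_of_primes (h : nat) :
  (0 < h)%N -> ~~ (4 %| h)%N -> (forall p, prime p -> odd p -> ~~ (p %| h)%N) ->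
  (h %| 2)%N.
Proof.
have odd1 n : (0 < n)%N -> odd n ->
    (forall p, prime p -> odd p -> ~~ (p %| n)%N) -> n = 1%N.
  move=> n0 on hp; apply/eqP; rewrite eqn_leq n0 andbT leqNgt; apply/negP => n1.
  have /negP[] := hp _ (pdiv_prime n1) (dvdn_odd (pdiv_dvd n) on).
  exact: pdiv_dvd.
move=> h0 h4 hp; have [oh|eh] := boolP (odd h).
  by rewrite (odd1 _ h0 oh hp).
have e : h = (2 * h./2)%N.
  by rewrite mul2n -[LHS]odd_double_half (negPf eh).
have h20 : (0 < h./2)%N by move: h0; rewrite {1}e muln_gt0.
rewrite e (odd1 _ h20) //; first last.
  by move=> p pp op; apply: contra (hp _ pp op) => ?; rewrite e dvdn_mull.
apply: contraR h4 => /negbTE o2; rewrite e (_ : 4 = 2 * 2)%N // dvdn_pmul2l //.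
by rewrite dvdn2 o2.
Qed.

(* Away from [2], an eigenvalue is [+- l0] modulo each prime of [gcd(s, g)], and
   [gcd(s, g, l - l0)] records the primes where the sign is [+]. *)
Lemma dvd_wedge_of_label (g s w l l' l0 dlt : int) :
  0 < g -> coprimez g dlt ->
  (s %| 2 * g * w)%Z -> (s %| (l + l') * w)%Z ->
  (s %| l ^+ 2 - dlt)%Z -> (s %| l' ^+ 2 - dlt)%Z -> (s %| l0 ^+ 2 - dlt)%Z ->
  gcdz (gcdz s g) (l - l0) = gcdz (gcdz s g) (l' - l0) ->
  (4 %| l - 1)%Z = (4 %| l' - 1)%Z ->
  (s %| 2 * w)%Z.
Proof.
move=> g0 co h1 h2 hl hl' hl0 er e4.
(* Both divisibilities combine into [s %| h * w]; it remains to exclude 4 and the odd primes as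
   divisors of [h]. *)
pose h := gcdz (gcdz (2 * g) (l + l')) s.
have hs : (h %| s)%Z by exact: dvdz_gcdr.
have hg : (h %| 2 * g)%Z by apply: dvdz_trans (dvdz_gcdl _ _) (dvdz_gcdl _ _).
have hll : (h %| l + l')%Z by apply: dvdz_trans (dvdz_gcdl _ _) (dvdz_gcdr _ _).
have hw : (s %| h * w)%Z.
  have absw x : (s %| x * `|w|%:Z)%Z = (s %| x * w)%Z.
    by rewrite !dvdzE !abszM absz_nat.
  by rewrite -absw /h mulz_gcdl dvdz_gcd -absw mulz_gcdl dvdz_gcd h1 h2 dvdz_mulr.
suff h2' : (h %| 2)%Z.
  by apply: dvdz_trans hw _; exact: dvdz_mul h2' (dvdzz w).
have h0 : (0 < `|h|)%N.
  rewrite absz_gt0 gcdz_eq0 negb_and gcdz_eq0 negb_and mulf_eq0 /=.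
  by rewrite (gt_eqF g0).
rewrite dvdzE; apply: dvdn2_of_primes => //.
  (* If 4 divides [h], then [g] is even, so [dlt] and both roots are odd. As [l + l'] is 0 modulo 4,
     exactly one root is 1 modulo 4, against [e4]. *)
  apply/negP => h4; have {h4} h4 : (4 %| h)%Z by rewrite dvdzE.
  have /dvdzP[g' eg] := dvdz_trans h4 hg.
  have /dvdzP[m em] := dvdz_trans h4 hll.
  have h4s := dvdz_trans h4 hs.
  have g2 : (2 %| g)%Z by apply/dvdzP; exists g'; move: eg; clear; lia.
  have d2 : ~~ (2 %| dlt)%Z.
    apply/negP => d2; have : (2 %| gcdz g dlt)%Z by rewrite dvdz_gcd g2.
    by move/eqP: co => ->.
  have oddl x : (s %| x ^+ 2 - dlt)%Z -> ~~ (2 %| x)%Z.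
    move=> /(dvdz_trans h4s)/dvdzP[n en]; apply: contra d2 => /dvdzP[x' ex].
    apply/dvdzP; exists (2 * x' ^+ 2 - 2 * n).
    have -> : dlt = x ^+ 2 - (x ^+ 2 - dlt) by ring.
    by rewrite en ex; ring.
  by move: (oddl _ hl) (oddl _ hl') e4 em; clear; lia.
(* An odd prime of [h] divides [s] and [g]. By the labels both roots have the same sign relative to
   [l0], so it divides [l - l'] as well as [l + l'], hence [l] and [dlt], against coprimality. *)
move=> p pp op; apply/negP => ph.
have {ph} ph : (p%:Z %| h)%Z by rewrite dvdzE.
have euclid x y : (p%:Z %| x * y)%Z = (p%:Z %| x)%Z || (p%:Z %| y)%Z.
  by rewrite !dvdzE abszM /= Euclid_dvdM.
have p2 : (p%:Z %| 2)%Z = false.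
  by rewrite dvdzE /= dvdn_prime2 //; apply/eqP => e; rewrite e in op.
have ps := dvdz_trans ph hs; have pll := dvdz_trans ph hll.
have pg : (p%:Z %| g)%Z by have := dvdz_trans ph hg; rewrite euclid p2.
have sq x : (s %| x ^+ 2 - dlt)%Z -> (p%:Z %| x - l0)%Z || (p%:Z %| x + l0)%Z.
  move=> hx; rewrite -euclid; apply: dvdz_trans ps _.
  have -> : (x - l0) * (x + l0) = (x ^+ 2 - dlt) - (l0 ^+ 2 - dlt) by ring.
  exact: rpredB.
have er' : (p%:Z %| l - l0)%Z = (p%:Z %| l' - l0)%Z.
  have aux x : (p%:Z %| gcdz (gcdz s g) (x - l0))%Z = (p%:Z %| x - l0)%Z.
    by rewrite !dvdz_gcd ps pg.
  by rewrite -!aux er.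
have pd : (p%:Z %| l - l')%Z.
  have [a|na] := boolP (p%:Z %| l - l0)%Z.
    have -> : l - l' = (l - l0) - (l' - l0) by ring.
    by rewrite rpredB // -er'.
  have -> : l - l' = (l + l0) - (l' + l0) by ring.
  have := sq _ hl; have := sq _ hl'; rewrite -er' (negPf na) /= => u1 u2.
  exact: rpredB.
have pl : (p%:Z %| l)%Z.
  suff : (p%:Z %| 2 * l)%Z by rewrite euclid p2.
  have -> : 2 * l = (l + l') + (l - l') by ring.
  exact: rpredD.
have pdlt : (p%:Z %| dlt)%Z.
  have -> : dlt = l * l - (l ^+ 2 - dlt) by ring.
  by rewrite rpredB ?dvdz_mulr //; exact: dvdz_trans ps hl.
have : (p%:Z %| gcdz g dlt)%Z by rewrite dvdz_gcd pg.
move/eqP: co => ->; rewrite dvdzE /= dvdn1 => /eqP e.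
by rewrite e in pp.
Qed.

Definition tdet (x y z : int * int * int) : int :=
  x.1.1 * (y.1.2 * z.2 - y.2 * z.1.2) - x.1.2 * (y.1.1 * z.2 - y.2 * z.1.1)
  + x.2 * (y.1.1 * z.1.2 - y.1.2 * z.1.1).

(** Multiplied by [s], a zero is the image of [(u ^+ 2, u * v, v ^+ 2)] under a fixed linear map of
    determinant [4 * g ^+ 2 * c] up to sign; for such vectors the determinant is a homogeneous
    Vandermonde, a product of wedges. *)
Lemma conic_param_tdet (g a b c s t1 y1 z1 u1 v1 l1 t2 y2 z2 u2 v2 l2
    t3 y3 z3 u3 v3 l3 : int) :
  conic_param g a b c t1 y1 z1 s u1 v1 l1 ->
  conic_param g a b c t2 y2 z2 s u2 v2 l2 ->
  conic_param g a b c t3 y3 z3 s u3 v3 l3 ->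
  s ^+ 3 * tdet (t1, y1, z1) (t2, y2, z2) (t3, y3, z3) =
  - (4 * (g ^+ 2 * c) * ((u1 * v2 - v1 * u2) * (u2 * v3 - v2 * u3)
                        * (u1 * v3 - v1 * u3))).
Proof.
move=> [_ _ _ t1e y1e z1e _ _ _ _ _] [_ _ _ t2e y2e z2e _ _ _ _ _].
move=> [_ _ _ t3e y3e z3e _ _ _ _ _].
have -> : s ^+ 3 * tdet (t1, y1, z1) (t2, y2, z2) (t3, y3, z3) =
  tdet (s * t1, s * y1, s * z1) (s * t2, s * y2, s * z2) (s * t3, s * y3, s * z3).
  by rewrite /tdet /=; ring.
rewrite t1e t2e t3e y1e y2e y3e z1e z2e z3e /tdet /=; ring.
Qed.

Lemma intr_wedge (R : realType) (u v u' v' : int) :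
  wedge (u%:~R, v%:~R) (u'%:~R, v'%:~R) = (u * v' - v * u')%:~R :> R.
Proof. by rewrite /wedge /= intrB !intrM. Qed.

(** A nonzero wedge is at least [s / 2] in size, and the determinant formula bounds a product of
    three by [(k * s) ^+ 3]. The packing bound thus applies with [2 * k] and [m = s / 2], and
    [4 * (4 * k + 1) <= 20 * k]. *)
Lemma conic_class_count (R : realType) (k W : R) (g a b c s : int)
    (Y : seq (int * int * int)) (F : int * int * int -> int * int * int) :
  1 <= k -> g != 0 -> c != 0 -> uniq Y ->
  {in Y, forall x, conic_param g a b c x.1.1 x.1.2 x.2 s (F x).1.1 (F x).1.2 (F x).2} ->
  {in Y &, forall x y,
    (s %| 2 * ((F x).1.1 * (F y).1.2 - (F x).1.2 * (F y).1.1))%Z} ->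
  {in Y & &, forall x y z, `|tdet x y z|%:~R <= W} ->
  W <= k ^+ 3 * (`|g ^+ 2 * c|)%:~R ->
  (size Y)%:R <= 20 * k.
Proof.
move=> k1 g0 c0 uY hF hw hW hk.
case eY : Y => [|x0 Y']; first by rewrite mulr_ge0 //; lra.
have x0Y : x0 \in Y by rewrite eY mem_head.
rewrite -eY; clear eY Y'.
have s0 : 0 < s by case: (hF _ x0Y).
have sR : 0 < s%:~R :> R by rewrite ltr0z.
have D0 : 0 < `|g ^+ 2 * c|%:~R :> R.
  by rewrite ltr0z normr_gt0 mulf_neq0 // expf_neq0.
pose v x : R * R := ((F x).1.1%:~R, (F x).1.2%:~R).
have : (size Y)%:R <= 4 * (2 * (2 * k) + 1) :> R; last by lra.
apply: (@planar_count R _ Y v (2 * k) (s%:~R / 2)) => //.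
- by lra.
- by rewrite divr_gt0.
- move=> x y xY yY xy; rewrite intr_wedge.
  set w := _ - _; have w0 : w != 0.
    apply: contra xy => /eqP w0; have := conic_param_inj (hF _ xY) (hF _ yY) w0.
    by move: x y {xY yY w w0} => [[? ?] ?] [[? ?] ?] /= ->.
  have : s <= 2 * `|w|.
    have : (s %| 2 * w)%Z by exact: hw.
    rewrite dvdzE abszM => /dvdn_leq h; have {h} : (`|s| <= 2 * `|w|)%N.
      by apply: h; rewrite muln_gt0 !absz_gt0 w0.
    by clear -s0; lia.
  rewrite -(ler_int R) intrM intr_norm; lra.
- move=> x y z xY yY zY; rewrite !intr_wedge -!normrM -!intrM.
  set w := _ * _ * _.
  have e : s ^+ 3 * `|tdet x y z| = 4 * `|g ^+ 2 * c| * `|w|.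
    have := conic_param_tdet (hF _ xY) (hF _ yY) (hF _ zY).
    have xe (u : int * int * int) : (u.1.1, u.1.2, u.2) = u by case: u => [[]].
    rewrite !xe => h.
    by rewrite -[s ^+ 3]gtr0_norm ?exprn_gt0 // -normrM h normrN -/w !normrM mulrA.
  have h : s%:~R ^+ 3 * `|tdet x y z|%:~R <=
      s%:~R ^+ 3 * (k ^+ 3 * (`|g ^+ 2 * c|)%:~R) :> R.
    rewrite ler_pM2l ?exprn_gt0 //; apply: le_trans hk; exact: hW.
  have eR : s%:~R ^+ 3 * `|tdet x y z|%:~R = 4 * `|g ^+ 2 * c|%:~R * `|w|%:~R :> R.
    by have := congr1 (fun u : int => u%:~R : R) e; rewrite rmorphM rmorphXn !rmorphM.
  rewrite eR in h; rewrite -(ler_pM2l D0) -intr_norm.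
  have -> : 2 * k * (s%:~R / 2) = k * s%:~R :> R by field.
  have eK : `|g ^+ 2 * c|%:~R * (k * s%:~R) ^+ 3 =
    s%:~R ^+ 3 * (k ^+ 3 * `|g ^+ 2 * c|%:~R) :> R by ring.
  have K0 : 0 <= `|g ^+ 2 * c|%:~R * (k * s%:~R) ^+ 3 :> R.
    by rewrite mulr_ge0 ?exprn_ge0 ?mulr_ge0 ?ltW //; lra.
  rewrite eK in K0 *; lra.
Qed.

Lemma isotropic_count (R : realType) (k W : R) (g a b c : int)
    (X : seq (int * int * int)) :
  1 <= k -> 0 < g -> c != 0 -> coprimez g (b ^+ 2 - a * c) -> uniq X ->
  {in X, forall x, [/\ 0 < x.1.2, gcdz x.1.1 (gcdz x.1.2 x.2) = 1 &
    2 * g * x.1.1 * x.1.2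
      + (a * x.1.2 ^+ 2 + 2 * b * x.1.2 * x.2 + c * x.2 ^+ 2) = 0]} ->
  {in X & &, forall x y z, `|tdet x y z|%:~R <= W} ->
  W <= k ^+ 3 * (`|g ^+ 2 * c|)%:~R ->
  (size X)%:R <= 80 * k * (d3 (absz (g ^+ 2 * c)%R))%:R.
Proof.
move=> k1 g0 c0 co uX hX hW hk; set D := absz (g ^+ 2 * c).
have D0 : (0 < D)%N by rewrite absz_gt0 mulf_neq0 // expf_neq0 // gt_eqF.
have [G hG] : exists G : int * int * int -> int * (int * int * int),
    forall x, x \in X -> conic_param g a b c x.1.1 x.1.2 x.2
      (G x).1 (G x).2.1.1 (G x).2.1.2 (G x).2.2.
  suff /choice[G hG] : forall x, exists y : int * (int * int * int), x \in X ->
    conic_param g a b c x.1.1 x.1.2 x.2 y.1 y.2.1.1 y.2.1.2 y.2.2 by exists G.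
  move=> x; have [xX|] := boolP (x \in X); last by exists (0, (0, 0, 0)).
  have [h1 h2 h3] := hX x xX.
  have [s [y1 [z1 [l h]]]] := ex_conic_param g0 h1 h2 h3.
  by exists (s, (y1, z1, l)).
(* The reference root for [s] is that of the first zero of [X] with this parameter; the default of
   [nth] is reached only for values of [s] that do not occur. *)
pose lam0 s := (G (nth (0, 0, 0) X (find (fun x => (G x).1 == s) X))).2.2.
pose r x := gcdz (gcdz (G x).1 g) ((G x).2.2 - lam0 (G x).1).
pose sg x := `|(G x).1|%N.
(* Since [s] divides [2 * (g * c)], halving it when even yields a divisor of [g * c]; the parity
   goes into the label. As [r x] divides [g], the product of the two divides [D]. *)
pose half x := if odd (sg x) then sg x else (sg x)./2.
pose label x := (odd (sg x), (4 %| (G x).2.2 - 1)%Z, (half x, `|r x|%N)).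
have s_gt0 x : x \in X -> 0 < (G x).1 by move=> /hG[].
have hdiv x : x \in X -> (half x * `|r x| %| D)%N.
  move=> xX; have sgc : (sg x %| 2 * absz (g * c)%R)%N.
    by case: (hG _ xX) => _ _ _ _ _ _ + _ _ _ _; rewrite dvdzE abszM.
  have rg : (`|r x| %| `|g|)%N.
    by apply: dvdn_trans (dvdn_gcdl _ _) (dvdn_gcdr _ _).
  have eD : D = (absz (g * c)%R * absz g)%N by rewrite /D -abszM; congr absz; ring.
  rewrite eD; apply: dvdn_mul => //; rewrite /half; case: ifP => [ev|/negbT ev].
    by rewrite -(@Gauss_dvdr _ 2) // coprimen2.
  rewrite -(@dvdn_pmul2l 2) // mul2n.
  by rewrite -[X in (X %| _)%N](_ : sg x = _) // -[LHS]odd_double_half (negPf ev).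
pose L := [seq (u, v) | u <- [seq (u, v) | u <- [:: true; false],
                                           v <- [:: true; false]],
                        v <- undup [seq (half x, `|r x|%N) | x <- X]].
have hL : (size L <= 4 * d3 D)%N.
  rewrite size_allpairs /= leq_mul2l /=; apply: size_pairs_le_d3 => //.
    exact: undup_uniq.
  by move=> u; rewrite mem_undup => /mapP[x xX ->]; exact: hdiv.
pose n := Num.truncn (20 * k).
have hn : (size X <= size L * n)%N.
  apply: (@size_le_fibers _ _ label) => [x xX|l].
    apply/allpairsP; exists (odd (sg x), (4 %| (G x).2.2 - 1)%Z, (half x, `|r x|%N)).
    split => //=; last by rewrite mem_undup; apply/mapP; exists x.
    by case: (odd _); case: (_ %| _)%Z.
  set Y := [seq x <- X | _]; have YX : {subset Y <= X}.
    by move=> x; rewrite mem_filter => /andP[].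
  have hY x : x \in Y -> label x = l by rewrite mem_filter => /andP[/eqP].
  case eY : Y => [//|x0 Y0]; have x0Y : x0 \in Y by rewrite eY mem_head.
  rewrite -eY; clear eY Y0; have x0X := YX _ x0Y.
  have hs x : x \in Y -> (G x).1 = (G x0).1.
    move=> xY; have := hY _ xY; rewrite -(hY _ x0Y) => -[eo _ eh _].
    have : sg x = sg x0.
      move: eh; rewrite /half eo; case: ifP => // ev eh.
      by rewrite -[LHS]odd_double_half -[RHS]odd_double_half eo ev eh.
    by move: (s_gt0 _ (YX _ xY)) (s_gt0 _ x0X); rewrite /sg; clear; lia.
  have hr x : x \in Y -> r x = r x0.
    by move=> xY; have := hY _ xY; rewrite -(hY _ x0Y) => -[_ _ _ h]; exact: (congr1 Posz h).
  have h4 x : x \in Y -> (4 %| (G x).2.2 - 1)%Z = (4 %| (G x0).2.2 - 1)%Z.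
    by move=> xY; have := hY _ xY; rewrite -(hY _ x0Y) => -[_ -> _ _].
  have hGY x : x \in Y -> conic_param g a b c x.1.1 x.1.2 x.2
      (G x0).1 (G x).2.1.1 (G x).2.1.2 (G x).2.2.
    by move=> xY; rewrite -(hs _ xY); apply: hG; exact: YX.
  rewrite truncn_ge_nat; last by lra.
  apply: (@conic_class_count R k W g a b c (G x0).1 Y (fun x => (G x).2)) => //.
  - by rewrite gt_eqF.
  - exact: filter_uniq.
  - move=> x y xY yY.
    have [p1 p2] := conic_param_pair (hGY _ xY) (hGY _ yY).
    have hl0 : ((G x0).1 %| lam0 (G x0).1 ^+ 2 - (b ^+ 2 - a * c))%Z.
      have hf : has (fun x => (G x).1 == (G x0).1) X by apply/hasP; exists x0.
      have := hG _ (mem_nth (0, 0, 0) (_ : (find (fun x => (G x).1 == (G x0).1) X < size X)%N)).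
      rewrite -has_find hf => /(_ isT).
      by have /eqP -> := nth_find (0, 0, 0) hf; case.
    apply: (dvd_wedge_of_label g0 co p1 p2 _ _ hl0).
    + by case: (hGY _ xY).
    + by case: (hGY _ yY).
    + by have := hr _ xY; rewrite -(hr _ yY) /r !hs.
    + by rewrite (h4 _ xY) (h4 _ yY).
  - by move=> x y z /YX xX /YX yX /YX zX; exact: hW.
have hnk : n%:R <= 20 * k by rewrite truncn_le; lra.
apply: (@le_trans _ _ ((4 * d3 D) * n)%:R).
  by rewrite ler_nat; apply: leq_trans hn _; rewrite leq_mul2r hL orbT.
rewrite !natrM; have : 0 <= (d3 D)%:R :> R by [].
by move: (d3 D)%:R (n%:R) hnk => u v h u0; nra.
Qed.

(** * Changes of lattice *)

Lemma det3 (A : 'M[int]_3) :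
  \det A = A 0 0 * (A 1 1 * A 2 2 - A 1 2 * A 2 1)
         - A 0 1 * (A 1 0 * A 2 2 - A 1 2 * A 2 0)
         + A 0 2 * (A 1 0 * A 2 1 - A 1 1 * A 2 0).
Proof.
pose f (m n : nat) : int := A (inord m) (inord n).
have e m n : A m n = f m n by rewrite /f !inord_val.
rewrite (expand_det_row _ 0) !big_ord_recl big_ord0 /cofactor.
rewrite !(expand_det_row _ 0) !big_ord_recl !big_ord0 /cofactor.
rewrite !det_mx11 !mxE !e /= /bump /=.
rewrite !(expr0, expr1, exprS, mul1r, mulr1, mulN1r, mulNr, mulrN, opprK) /=; ring.
Qed.

Definition triple_mx (x y z : 'cV[int]_3) : 'M[int]_3 :=
  \matrix_(i, j) (if j == 0 then x i 0 else if j == 1 then y i 0 else z i 0).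

Lemma mulmx_triple_mx (T : 'M[int]_3) (x y z : 'cV[int]_3) :
  triple_mx (T *m x) (T *m y) (T *m z) = T *m triple_mx x y z.
Proof.
apply/matrixP => i j; rewrite !mxE.
case: ifP => h0; [|case: ifP => h1]; apply: eq_bigr => l _; rewrite mxE h0 //.
  by rewrite h1.
by rewrite h1.
Qed.

Definition coords (x : 'cV[int]_3) : int * int * int := (x 0 0, x 1 0, x 2 0).

Lemma det_triple_mx (x y z : 'cV[int]_3) :
  \det (triple_mx x y z) = tdet (coords x) (coords y) (coords z).
Proof. by rewrite det3 /tdet !mxE /=; ring. Qed.

Lemma coords_inj : injective coords.
Proof.
move=> x y [e0 e1 e2]; apply/colP => i.
case: i => [[|[|[|//]]] h].
- by rewrite (_ : Ordinal h = 0) //; exact: val_inj.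
- by rewrite (_ : Ordinal h = 1) //; exact: val_inj.
- by rewrite (_ : Ordinal h = 2) //; exact: val_inj.
Qed.

Lemma primitive_mulmx (T : 'M[int]_3) (y : 'cV[int]_3) :
  primitive (T *m y) -> primitive y.
Proof.
rewrite /primitive -!dvdn1; apply: dvdn_trans; set g := (X in (X %| _)%N).
have gy j : (g%:Z %| y j ord0)%Z.
  by rewrite dvdzE absz_nat; have /dvdn_biggcdP -> := dvdnn g.
apply/dvdn_biggcdP => i _; rewrite mxE -[g]absz_nat -dvdzE.
by apply: rpred_sum => j _; exact: dvdz_mull.
Qed.

(** Up to sign, the minors are the entries of the adjugate; in this form their divisibility follows
    from matrix identities. *)
Lemma dvdn_gcd_minors2 (d : nat) (M : 'M[int]_3) :
  reflect (forall i j, (d%:Z %| \adj M i j)%Z) (d %| gcd_minors2 M)%N.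
Proof.
have e i j : (d%:Z %| \adj M i j)%Z = (d %| `|\det (row' j (col' i M))|)%N.
  by rewrite mxE /cofactor dvdzE abszM abszX exp1n mul1n.
apply: (iffP idP) => [/dvdn_biggcdP h i j|h].
  by rewrite e; have /dvdn_biggcdP -> := h j isT.
by apply/dvdn_biggcdP => i _; apply/dvdn_biggcdP => j _; rewrite -e.
Qed.

Lemma mulmx_det_inj (R : idomainType) (m n : nat) (A : 'M[R]_m)
    (B C : 'M[R]_(m, n)) :
  \det A != 0 -> A *m B = A *m C -> B = C.
Proof.
move=> d0 /(congr1 (mulmx (\adj A))); rewrite !mulmxA mul_adj_mx !mul_scalar_mx.
move=> h; apply/matrixP => i j; apply: (mulfI d0).
by have /matrixP/(_ i j) := h; rewrite !mxE.
Qed.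

Lemma det_congruence (M M' T : 'M[int]_3) (e : int) :
  e != 0 -> \det T ^+ 2 = e ^+ 2 -> T^T *m M *m T = e *: M' ->
  \det M = e * \det M'.
Proof.
move=> e0 dT /(congr1 determinant); rewrite !det_mulmx det_tr detZ => h.
apply: (mulfI (_ : e ^+ 2 != 0)); first exact: expf_neq0.
by rewrite mulrA -exprSr -h -dT; ring.
Qed.

(** Checked after multiplication on the left by [T^T *m M], which can be cancelled because both
    determinants are nonzero. *)
Lemma adj_congruence (M M' T : 'M[int]_3) (e : int) :
  e != 0 -> \det T ^+ 2 = e ^+ 2 -> \det M != 0 -> T^T *m M *m T = e *: M' ->
  \adj M = T *m \adj M' *m T^T.
Proof.
move=> e0 dT d0 congM.
have dT0 : \det T^T != 0.
  by have := expf_neq0 2 e0; rewrite -dT expf_eq0 /= det_tr.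
apply: (mulmx_det_inj d0); rewrite mul_mx_adj; apply: (mulmx_det_inj dT0).
rewrite !mulmxA congM -!scalemxAl mul_mx_adj (det_congruence e0 dT congM).
by rewrite mul_mx_scalar mul_scalar_mx scalerA.
Qed.

(** By the adjugate identity, the minors of [M] are integer combinations of those of [M']. *)
Lemma gcd_minors2_congruence (M M' T : 'M[int]_3) (e : int) :
  e != 0 -> \det T ^+ 2 = e ^+ 2 -> \det M != 0 -> T^T *m M *m T = e *: M' ->
  (gcd_minors2 M' %| gcd_minors2 M)%N.
Proof.
move=> e0 dT d0 congM; apply/dvdn_gcd_minors2 => i j.
have /dvdn_gcd_minors2 h := dvdnn (gcd_minors2 M').
rewrite (adj_congruence e0 dT d0 congM) mxE; apply: rpred_sum => k _.
rewrite dvdz_mulr // mxE; apply: rpred_sum => l _.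
exact: dvdz_mull.
Qed.

Lemma gcd_minors2_neq0 (M : 'M[int]_3) : \det M != 0 -> gcd_minors2 M != 0%N.
Proof.
apply: contra => /eqP h0.
have /dvdn_gcd_minors2 h : (0 %| gcd_minors2 M)%N by rewrite h0.
have adj0 : \adj M = 0.
  by apply/matrixP => i j; rewrite [RHS]mxE; apply/eqP; have := h i j; rewrite dvd0z.
have := mul_mx_adj M; rewrite adj0 mulmx0 => /matrixP/(_ 0 0).
by rewrite !mxE eqxx mulr1n => /esym/eqP.
Qed.

Lemma gcd_minors2Z (p : nat) (M : 'M[int]_3) :
  (p ^ 2 * gcd_minors2 M %| gcd_minors2 (p%:Z *: M))%N.
Proof.
apply/dvdn_gcd_minors2 => i j; rewrite adjZ mxE dvdzE abszM abszX !absz_nat.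
have /dvdn_gcd_minors2/(_ i j) := dvdnn (gcd_minors2 M).
by rewrite dvdzE absz_nat; exact: dvdn_mul.
Qed.

(** * Descent at a prime dividing all minors *)

Lemma det2 (A : 'M[int]_2) : \det A = A 0 0 * A 1 1 - A 0 1 * A 1 0.
Proof.
pose f (m n : nat) : int := A (inord m) (inord n).
have e m n : A m n = f m n by rewrite /f !inord_val.
rewrite (expand_det_row _ 0) !big_ord_recl big_ord0 /cofactor.
by rewrite !det_mx11 !mxE !e /= /bump /= expr0 expr1; ring.
Qed.

Lemma lift_pair3 (i j : 'I_3) : (i < j)%N -> exists r : 'I_3, lift r 0 = i /\ lift r 1 = j.
Proof.
case: i j => [[|[|[|//]]] hi] [[|[|[|//]]] hj] //= _;
  [exists 2|exists 1|exists 0]; by split; apply: val_inj.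
Qed.

Lemma dvdz_minor2 (p : nat) (M : 'M[int]_3) (i j k l : 'I_3) :
  (p %| gcd_minors2 M)%N -> (p%:Z %| M i k * M j l - M i l * M j k)%Z.
Proof.
move=> /dvdn_gcd_minors2 hp.
have lt_dvd (a b c d : 'I_3) : (a < b)%N -> (c < d)%N ->
    (p%:Z %| M a c * M b d - M a d * M b c)%Z.
  move=> /lift_pair3[r [<- <-]] /lift_pair3[s [<- <-]].
  have := hp s r; rewrite mxE /cofactor det2 !mxE.
  by rewrite dvdzE abszM abszX exp1n mul1n -dvdzE.
have lt1_dvd (a b : 'I_3) : (a < b)%N -> (p%:Z %| M a k * M b l - M a l * M b k)%Z.
  move=> ab; case: (ltngtP k l) => [kl|lk|/val_inj ->].
  - exact: lt_dvd.
  - by rewrite -opprB rpredN; exact: lt_dvd.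
  - by rewrite subrr dvdz0.
case: (ltngtP i j) => [ij|ji|/val_inj ->].
- exact: lt1_dvd.
- by rewrite mulrC [M i l * _]mulrC -opprB rpredN; exact: lt1_dvd.
- by rewrite [M j k * _]mulrC subrr dvdz0.
Qed.

Lemma scale_of_dvd (m n : nat) (d : int) (A : 'M[int]_(m, n)) :
  (forall i j, (d %| A i j)%Z) -> exists B, A = d *: B.
Proof.
move=> h; exists (\matrix_(i, j) (A i j %/ d)%Z).
by apply/matrixP => i j; rewrite !mxE mulrC divzK.
Qed.

Lemma det_transvection3 (r : 'rV[int]_3) (i : 'I_3) :
  \det (1%:M + delta_mx i 0 *m r) = 1 + r 0 i.
Proof.
have E (j k : 'I_3) : (1%:M + delta_mx i 0 *m r) j k = (j == k)%:R + (j == i)%:R * r 0 k.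
  by rewrite !mxE big_ord1 !mxE eqxx andbT.
rewrite det3 !E.
by case: i {E} => [[|[|[|//]]] h]; rewrite /= !(mul0r, mul1r);
  [rewrite (_ : Ordinal h = 0)|rewrite (_ : Ordinal h = 1)|rewrite (_ : Ordinal h = 2)];
  rewrite /=; try ring; apply: val_inj.
Qed.

(* When [M] has rank one modulo [p], [M i i * q x = (M x)_i ^+ 2] modulo [p], so
   the zeros of [q] lie in the sublattice [p %| (M x)_i], the image of [T]. *)
Lemma descent_matrix (p : nat) (M : 'M[int]_3) (i : 'I_3) :
  prime p -> (p %| gcd_minors2 M)%N -> M^T = M -> ~~ (p%:Z %| M i i)%Z ->
  exists T M' : 'M[int]_3, [/\ \det T = p%:Z, T^T *m M *m T = p%:Z *: M' &
    forall x : 'cV[int]_3, (x^T *m M *m x) 0 0 = 0 -> exists y, x = T *m y].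
Proof.
move=> pp pD sM pM.
have sMe j k : M j k = M k j by rewrite -[in LHS]sM mxE.
have [u [v uv]] : exists u v, u * M i i = 1 + p%:Z * v.
  have : coprimez p%:Z (M i i) by rewrite coprimezE absz_nat prime_coprime.
  move=> /coprimezP[[a b] /= ab]; exists b, (- a); rewrite -ab; ring.
have p0 : p%:Z != 0 by rewrite -lt0n prime_gt0.
(* Modulo [p] this is [- u] times row [i] of [M], corrected so that its entry [i] is [p - 1]. Hence
   [T] below has determinant [p], and [p] divides [M *m T]. *)
pose r : 'rV[int]_3 := (p%:Z * (1 + v)) *: delta_mx 0 i - u *: row i M.
have rE k : r 0 k = p%:Z * (1 + v) * (k == i)%:R - u * M i k.
  by rewrite !mxE eqxx.
pose T := 1%:M + delta_mx i 0 *m r.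
have MTE j k : (M *m T) j k = M j k + M j i * r 0 k.
  by rewrite mulmxDr mulmx1 mulmxA -colE mxE [X in _ + X]mxE big_ord1 mxE.
have [N eN] : exists N, M *m T = p%:Z *: N.
  apply: scale_of_dvd => j k; rewrite MTE rE.
  have -> : M j k + M j i * (p%:Z * (1 + v) * (k == i)%:R - u * M i k) =
      u * (M i i * M j k - M i k * M j i)
      + p%:Z * (M j i * ((1 + v) * (k == i)%:R) - v * M j k).
    have e : M j k = u * M i i * M j k - p%:Z * v * M j k by rewrite uv; ring.
    by rewrite {1}e; ring.
  by apply: rpredD; [apply: dvdz_mull; exact: dvdz_minor2|exact: dvdz_mulr].
exists T, (T^T *m N); split.
- rewrite det_transvection3 rE eqxx mulr1 uv; ring.
- by rewrite -mulmxA eN -scalemxAr.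
move=> x qx; pose m := (M *m x) i 0.
have rx : (r *m x) 0 0 = p%:Z * (1 + v) * x i 0 - u * m.
  by rewrite mulmxBl -!scalemxAl -rowE -row_mul /m !mxE.
have pm : (p%:Z %| m)%Z.
  have : (p%:Z %| m * m)%Z.
    (* The sum is [M i i] times the value of the form at [x], which is 0, minus [m * m]; its
       coefficients are minors. *)
    have -> : m * m = - (\sum_j \sum_k (M i i * M j k - M i k * M j i) * (x j 0 * x k 0)).
      have q2 : \sum_j \sum_k M i i * M j k * (x j 0 * x k 0) = 0.
        transitivity (M i i * (x^T *m M *m x) 0 0); last by rewrite qx mulr0.
        rewrite -mulmxA mxE mulr_sumr.
        apply: eq_bigr => j _; rewrite !mxE mulr_sumr mulr_sumr.
        by apply: eq_bigr => k _; ring.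
      have -> : m * m = \sum_j \sum_k M i k * M j i * (x j 0 * x k 0).
        rewrite {1}/m mxE mulr_suml; apply: eq_bigr => j _; rewrite /m mxE mulr_sumr.
        by apply: eq_bigr => k _; rewrite (sMe j i); ring.
      apply/eqP; rewrite -addr_eq0; apply/eqP; rewrite -[RHS]q2 -big_split /=.
      apply: eq_bigr => j _; rewrite -big_split /=.
      by apply: eq_bigr => k _; ring.
    rewrite rpredN; apply: rpred_sum => j _; apply: rpred_sum => k _.
    by apply: dvdz_mulr; exact: dvdz_minor2.
  by rewrite !dvdzE abszM /= Euclid_dvdM // orbb.
have /dvdzP[t et] : (p%:Z %| (r *m x)%R ord0 ord0)%Z.
  by rewrite rx; apply: rpredB; [rewrite -mulrA; exact: dvdz_mulr|exact: dvdz_mull].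
(* With [r *m x = t * p], the value of [r] at this vector is [t * p - t * (p - 1) = t], so [T] adds
   back what was subtracted. *)
exists (x - t *: delta_mx i 0).
rewrite mulmxDl mul1mx -mulmxA mulmxBr -scalemxAr.
have -> : r *m delta_mx i 0 = (p%:Z - 1)%:M.
  rewrite -colE; apply/matrixP => a b; rewrite !ord1 mxE rE eqxx mulr1 uv mxE eqxx mulr1n; ring.
have -> : r *m x = (t * p%:Z)%:M.
  by apply/matrixP => a b; rewrite !ord1 et mxE eqxx.
have -> : (t * p%:Z)%:M - t *: (p%:Z - 1)%:M = t%:M :> 'M[int]_1.
  by rewrite scale_scalar_mx -raddfB /=; congr (_%:M); ring.
by rewrite mul_mx_scalar subrK.
Qed.

(** * Counting zeros *)

(** The box is replaced by the bound it gives on determinants of three zeros, which, unlike a box,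
    behaves well under a change of lattice. *)
Definition small_zeros (R : realType) (W : R) (M : 'M[int]_3)
    (X : seq 'cV[int]_3) : Prop :=
  [/\ uniq X,
      {in X, forall x, primitive x /\ (x^T *m M *m x) 0 0 = 0} &
      {in X & &, forall x y z, `|\det (triple_mx x y z)|%:~R <= W}].

Lemma small_zeros_transport (R : realType) (W : R) (M M' T : 'M[int]_3)
    (e : int) (X : seq 'cV[int]_3) :
  e != 0 -> \det T != 0 -> T^T *m M *m T = e *: M' ->
  {in X, forall x, exists y, x = T *m y} -> small_zeros W M X ->
  exists2 X' : seq 'cV[int]_3, size X' = size X &
    small_zeros (W / `|\det T|%:~R) M' X'.
Proof.
move=> e0 dT congM hX [uX pX dX].
have [f fP] : exists f : 'cV[int]_3 -> 'cV[int]_3, forall x, x \in X -> x = T *m f x.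
  suff /choice[f fP] : forall x : 'cV[int]_3, exists y, x \in X -> x = T *m y.
    by exists f.
  move=> x; have [/hX[y ->]|] := boolP (x \in X); first by exists y.
  by exists 0.
exists [seq f x | x <- X]; first by rewrite size_map.
split.
- rewrite map_inj_in_uniq // => x y xX yX exy.
  by rewrite (fP x xX) (fP y yX) exy.
- move=> _ /mapP[x xX ->]; have [px qx] := pX x xX; split.
    by apply: (@primitive_mulmx T); rewrite -(fP x xX).
  have : (T *m f x)^T *m M *m (T *m f x) = e *: ((f x)^T *m M' *m f x).
    rewrite trmx_mul !mulmxA -[_ *m T^T *m M]mulmxA -[_ *m _ *m T]mulmxA congM.
    by rewrite -scalemxAr -scalemxAl.
  rewrite -(fP x xX) => /matrixP/(_ 0 0); rewrite qx mxE => /esym/eqP.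
  by rewrite mulf_eq0 (negPf e0) /= => /eqP.
- move=> _ _ _ /mapP[x xX ->] /mapP[y yX ->] /mapP[z zX ->].
  rewrite ler_pdivlMr ?ltr0z ?normr_gt0 // -intrM -normrM mulrC -det_mulmx.
  by rewrite -mulmx_triple_mx -!fP //; exact: dX.
Qed.

(** * Counting in an isotropic basis, and the induction on the determinant *)

(** A Smith form of [x] gives a basis whose first vector is proportional to [x]. A Smith form of the
    rest of the first row of the new matrix then gives a change of the other two vectors that clears
    the last entry. *)
Lemma isotropic_basis (M : 'M[int]_3) (x : 'cV[int]_3) :
  x != 0 -> (x^T *m M *m x) 0 0 = 0 ->
  exists U : 'M[int]_3, [/\ \det U ^+ 2 = 1, (U^T *m M *m U) 0 0 = 0 &
    (U^T *m M *m U) 0 2 = 0].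
Proof.
move=> x0 qx.
have det2_unit n (A : 'M[int]_n) : A \in unitmx -> \det A ^+ 2 = 1.
  by rewrite unitmxE => /orP[] /eqP ->.
have [L uL [R1 _ [d _ ex]]] := int_Smith_normal_form x.
pose e1 : 'cV[int]_3 := delta_mx 0 0.
have [t ext] : exists t, x = t *: (L *m e1).
  exists (d`_0 * R1 0 0); rewrite ex -mulmxA scalemxAr; congr (_ *m _).
  apply/colP => i; rewrite !mxE big_ord1 !mxE eqxx andbT mulr_natr mulrnAl.
  by case: i => [[|[|[|//]]] h]; rewrite /= ?mulr0n ?mulr1n.
have t0 : t != 0 by apply: contra x0 => /eqP t0; rewrite ext t0 scale0r.
set M1 := L^T *m M *m L.
have M100 : M1 0 0 = 0.
  have : x^T *m M *m x = (t * t) *: (e1^T *m M1 *m e1).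
    by rewrite ext [(_ *: _)^T]linearZ /= -!scalemxAl -scalemxAr scalerA trmx_mul /M1 !mulmxA.
  move=> /matrixP/(_ 0 0)/esym/eqP; rewrite qx [X in X == _]mxE !mulf_eq0.
  by rewrite (negPf t0) /= trmx_delta -rowE -colE !mxE => /eqP.
pose M1' : 'M[int]_(1 + 2) := M1; pose v : 'rV[int]_2 := ursubmx M1'.
have [l _ [R2 uR2 [d2 _ ev]]] := int_Smith_normal_form v.
pose V := invmx R2; pose U2 : 'M[int]_(1 + 2) := block_mx 1%:M 0 0 V.
have eM' : U2^T *m M1' *m U2 = block_mx (ulsubmx M1') (v *m V)
     (V^T *m dlsubmx M1') (V^T *m drsubmx M1' *m V).
  rewrite -{1}[M1']submxK /U2 tr_block_mx !mulmx_block !trmx0 trmx1.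
  by rewrite !(mul1mx, mulmx1, mul0mx, mulmx0, add0r, addr0).
have eLU : (L *m U2)^T *m M *m (L *m U2) = block_mx (ulsubmx M1') (v *m V)
     (V^T *m dlsubmx M1') (V^T *m drsubmx M1' *m V).
  by rewrite -eM' trmx_mul /M1' /M1 !mulmxA.
have ul (A : 'M[int]_(1 + 2)) : (A : 'M[int]_3) 0 0 = A (lshift 2 0) (lshift 2 0).
  by congr (A _ _); exact: val_inj.
have ur (A : 'M[int]_(1 + 2)) : (A : 'M[int]_3) 0 2 = A (lshift 2 0) (rshift 1 1).
  by congr (A _ _); exact: val_inj.
exists (L *m U2); split.
- have detU2 : \det U2 = \det V by rewrite /U2 det_ublock det1 mul1r.
  by rewrite det_mulmx exprMn det2_unit // mul1r [\det _]detU2 det2_unit // unitmx_inv.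
- rewrite eLU ul block_mxEul -[RHS]M100 2![LHS]mxE.
  by congr (M1 _ _); exact: val_inj.
- rewrite eLU ur block_mxEur ev /V mulmxK // mxE big_ord1 !mxE /= mulr0n.
  exact: mulr0.
Qed.

(** The first row and column have [M 0 1] as their only possibly nonzero entry, so it divides every
    minor except that of the lower right block. *)
Lemma gcd_minors2_isotropic (M : 'M[int]_3) :
  M^T = M -> M 0 0 = 0 -> M 0 2 = 0 -> gcd_minors2 M = 1%N ->
  coprimez (M 0 1) (M 1 2 ^+ 2 - M 1 1 * M 2 2).
Proof.
move=> sM m00 m02 D1; set g := M 0 1; set dl := _ - _.
have sMe i j : M i j = M j i by rewrite -[in LHS]sM mxE.
suff : (`|gcdz g dl| %| gcd_minors2 M)%N by rewrite D1 dvdn1.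
set h := `|_|%N.
have hg : (h%:Z %| g)%Z by rewrite dvdzE absz_nat; exact: dvdn_gcdl.
have hd : (h%:Z %| (M 1 1 * M 2 2 - M 1 2 * M 1 2)%R)%Z.
  rewrite -rpredN opprB -expr2 dvdzE absz_nat; exact: dvdn_gcdr.
apply/dvdn_gcd_minors2 => i j; rewrite mxE /cofactor det2 !mxE.
have l00 : lift (0 : 'I_3) (0 : 'I_2) = 1 by exact: val_inj.
have l01 : lift (0 : 'I_3) (1 : 'I_2) = 2 by exact: val_inj.
have l10 : lift (1 : 'I_3) (0 : 'I_2) = 0 by exact: val_inj.
have l11 : lift (1 : 'I_3) (1 : 'I_2) = 2 by exact: val_inj.
have l20 : lift (2 : 'I_3) (0 : 'I_2) = 0 by exact: val_inj.
have l21 : lift (2 : 'I_3) (1 : 'I_2) = 1 by exact: val_inj.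
have i3 (k : 'I_3) : [\/ k = 0, k = 1 | k = 2].
  by case: k => [[|[|[|//]]] ?]; [apply: Or31|apply: Or32|apply: Or33]; exact: val_inj.
apply: dvdz_mull.
case: (i3 i) => ->; case: (i3 j) => ->;
  rewrite ?(l00, l01, l10, l11, l20, l21) ?(sMe 1 0) ?(sMe 2 0) ?(sMe 2 1) ?m00 ?m02 -/g;
  first [exact: hd|by rewrite ?mul0r ?mulr0 ?subr0 ?sub0r ?rpredN ?(dvdz0, dvdz_mulr, dvdz_mull)].
Qed.

Lemma primitive_gcdz (x : 'cV[int]_3) :
  primitive x -> gcdz (x 0 0) (gcdz (x 1 0) (x 2 0)) = 1.
Proof.
have i1 : lift ord0 ord0 = 1 :> 'I_3 by exact: val_inj.
have i2 : lift ord0 (lift ord0 ord0) = 2 :> 'I_3 by exact: val_inj.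
rewrite /primitive !big_ord_recl big_ord0 gcdn0 i1 i2 => /eqP h.
rewrite /gcdz absz_nat; apply: (congr1 Posz (y := 1%N)); exact: h.
Qed.

Lemma qform_isotropic (M : 'M[int]_3) (x : 'cV[int]_3) :
  M^T = M -> M 0 0 = 0 -> M 0 2 = 0 ->
  (x^T *m M *m x) 0 0 = 2 * M 0 1 * x 0 0 * x 1 0
    + (M 1 1 * x 1 0 ^+ 2 + 2 * M 1 2 * x 1 0 * x 2 0 + M 2 2 * x 2 0 ^+ 2).
Proof.
move=> sM m00 m02; have sMe i j : M i j = M j i by rewrite -[in LHS]sM mxE.
rewrite mxE !big_ord_recl big_ord0 !mxE !big_ord_recl !big_ord0 !mxE.
have -> : lift ord0 ord0 = 1 :> 'I_3 by exact: val_inj.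
have -> : lift ord0 (lift ord0 ord0) = 2 :> 'I_3 by exact: val_inj.
by rewrite (sMe 1 0) (sMe 2 0) (sMe 2 1) m00 m02; ring.
Qed.

(** Sign changes of the coordinates make [g] and the second coordinate positive, as the
    parametrisation requires. *)
Lemma isotropic_half_count (R : realType) (k W : R) (M : 'M[int]_3) (ep : int)
    (Y : seq 'cV[int]_3) :
  1 <= k -> M^T = M -> M 0 0 = 0 -> M 0 2 = 0 -> gcd_minors2 M = 1%N ->
  \det M != 0 -> `|ep| = 1 -> {in Y, forall x : 'cV[int]_3, 0 < ep * x 1 0} ->
  small_zeros W M Y -> W <= k ^+ 3 * (`|\det M|)%:~R ->
  (size Y)%:R <= 80 * k * (d3 (absz (\det M)))%:R.
Proof.
move=> k1 sM m00 m02 D1 dM ep1 hY [uY pY dY] hk.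
have sMe i j : M i j = M j i by rewrite -[in LHS]sM mxE.
have eD : \det M = - (M 0 1 ^+ 2 * M 2 2).
  by rewrite det3 m00 m02 (sMe 1 0) (sMe 2 0) m02; ring.
set g := M 0 1 in eD *; set c := M 2 2 in eD *.
have g0 : g != 0 by apply: contra dM => /eqP h; rewrite eD h expr0n mul0r oppr0.
have c0 : c != 0 by apply: contra dM => /eqP h; rewrite eD h mulr0 oppr0.
pose sg := Num.sg g; have sgE : sg * `|g| = g by rewrite -numEsg.
have sg1 : `|sg| = 1 by rewrite normr_sg g0.
have sg0 : sg != 0 by rewrite sgr_eq0.
have ep0 : ep != 0 by rewrite -normr_gt0 ep1.
have ep2 : ep ^+ 2 = 1 by rewrite -(ger0_norm (sqr_ge0 ep)) normrX ep1 expr1n.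
have eD' : `|(`|g| ^+ 2 * c)| = `|\det M|.
  by rewrite eD normrN !normrM !normr_id.
pose f (x : 'cV[int]_3) : int * int * int := (ep * sg * x 0 0, ep * x 1 0, ep * x 2 0).
have -> : absz (\det M) = absz (`|g| ^+ 2 * c)%R.
  by apply/eqP; rewrite -eqz_nat !abszE eD'.
rewrite -(size_map f).
apply: (@isotropic_count R k W `|g| (M 1 1) (M 1 2) c) => //.
- by rewrite normr_gt0.
- by have := gcd_minors2_isotropic sM m00 m02 D1; rewrite /coprimez /gcdz absz_id.
- rewrite map_inj_uniq // => x y [/(mulfI (mulf_neq0 ep0 sg0)) e0].
  by move=> /(mulfI ep0) e1 /(mulfI ep0) e2; apply: coords_inj; rewrite /coords e0 e1 e2.
- move=> _ /mapP[x xY ->]; have [px qx] := pY x xY; split; first exact: hY.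
    have ea (u v : int) : `|u| = 1 -> absz (u * v)%R = absz v.
      by move=> u1; apply/eqP; rewrite -eqz_nat !abszE normrM u1 mul1r.
    have := primitive_gcdz px; rewrite /gcdz !absz_nat /=.
    by rewrite !ea // normrM ep1 sg1.
  move: qx; rewrite (qform_isotropic _ sM m00 m02) -/g -/c /= => qx.
  rewrite -[RHS](mulr0 (ep ^+ 2)) -[in RHS]qx -{2}sgE; ring.
- move=> _ _ _ /mapP[x xY ->] /mapP[y yY ->] /mapP[z zY ->].
  have -> : tdet (f x) (f y) (f z) = ep ^+ 2 * (ep * sg) * \det (triple_mx x y z).
    by rewrite det_triple_mx /tdet /f /coords /=; ring.
  by rewrite ep2 mul1r !normrM ep1 sg1 !mul1r; exact: dY.
- by rewrite eD'.
Qed.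

Lemma isotropic_primitive_zeros (M : 'M[int]_3) (x : 'cV[int]_3) :
  M^T = M -> M 0 0 = 0 -> M 0 2 = 0 -> \det M != 0 ->
  primitive x -> (x^T *m M *m x) 0 0 = 0 -> x 1 0 = 0 ->
  coords x \in [:: (1, 0, 0); (-1, 0, 0)].
Proof.
move=> sM m00 m02 dM px; rewrite (qform_isotropic _ sM m00 m02) => qx x1.
have c0 : M 2 2 != 0.
  have sMe i j : M i j = M j i by rewrite -[in LHS]sM mxE.
  apply: contra dM => /eqP h.
  by rewrite det3 m00 m02 (sMe 1 0) (sMe 2 0) m02 h; apply/eqP; ring.
have x2 : x 2 0 = 0.
  move: qx; rewrite x1 expr0n !(mulr0, mul0r, add0r) => /eqP.
  by rewrite mulf_eq0 (negPf c0) expf_eq0 => /eqP.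
have := primitive_gcdz px; rewrite x1 x2 /coords !inE x1 x2 /gcdz /=.
by case: (x 0 0) => [[|[|n]]|[|n]].
Qed.

(** In an isotropic basis the zeros are split by the sign of the second coordinate: the constant is
    80 for each sign, plus 2 for the base point and its opposite. *)
Lemma count_coprime_minors (R : realType) (k W : R) (M : 'M[int]_3)
    (X : seq 'cV[int]_3) :
  1 <= k -> M^T = M -> gcd_minors2 M = 1%N -> \det M != 0 ->
  small_zeros W M X -> W <= k ^+ 3 * (`|\det M|)%:~R ->
  (size X)%:R <= 162 * k * (d3 (absz (\det M)))%:R.
Proof.
move=> k1 sM D1 dM zX hk.
case eX : X => [|x0 Y0]; first by rewrite !mulr_ge0 //; lra.
have [_ /(_ x0)] := zX; rewrite {1}eX mem_head => /(_ isT)[px0 qx0] _.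
rewrite -eX; clear eX Y0.
have x00 : x0 != 0.
  apply/eqP => e; move: (primitive_gcdz px0).
  by rewrite e !mxE.
have [U [dU U00 U02]] := isotropic_basis x00 qx0.
set M' := U^T *m M *m U in U00 U02.
have congM : U^T *m M *m U = 1 *: M' by rewrite scale1r.
have dU2 : \det U ^+ 2 = 1 ^+ 2 by rewrite dU expr1n.
have dU0 : \det U != 0 by apply/eqP => h; move: dU; rewrite h expr0n.
have dU1 : `|\det U| = 1.
  by apply/eqP; rewrite -sqrp_eq1 // -normrX dU normr1.
have eD : \det M = \det M' by rewrite (det_congruence _ dU2 congM) // mul1r.
have sM' : M'^T = M' by rewrite /M' !trmx_mul trmxK sM mulmxA.
have D1' : gcd_minors2 M' = 1%N.
  have := gcd_minors2_congruence (oner_neq0 _) dU2 dM congM.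
  by rewrite D1 dvdn1 => /eqP.
have [|X' <- zX'] := small_zeros_transport (oner_neq0 _) dU0 congM _ zX.
  move=> x _; exists (\det U *: (\adj U *m x)).
  by rewrite -scalemxAr mulmxA mul_mx_adj mul_scalar_mx scalerA -expr2 dU scale1r.
move: zX'; rewrite dU1 divr1 => -[uX pX dX].
have sub P : small_zeros W M' [seq x : 'cV[int]_3 <- X' | P x].
  split; first exact: filter_uniq.
    by move=> x; rewrite mem_filter => /andP[_ /pX].
  move=> x y z; rewrite !mem_filter => /andP[_ xX] /andP[_ yX] /andP[_ zX'].
  exact: dX.
rewrite eD in hk dM *; set d := (d3 _)%:R.
pose X0 := [seq x : 'cV[int]_3 <- X' | x 1 0 == 0].
pose Xp := [seq x : 'cV[int]_3 <- X' | 0 < x 1 0].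
pose Xn := [seq x : 'cV[int]_3 <- X' | x 1 0 < 0].
have h1 : (size Xp)%:R <= 80 * k * d :> R.
  apply: (@isotropic_half_count R k W M' 1) => //; last exact: sub.
  by move=> x; rewrite mem_filter mul1r => /andP[].
have h2 : (size Xn)%:R <= 80 * k * d :> R.
  apply: (@isotropic_half_count R k W M' (-1)) => //; last exact: sub.
  by move=> x; rewrite mem_filter mulN1r oppr_gt0 => /andP[].
have h3 : (size X0 <= 2)%N.
  rewrite -(size_map coords) -[2%N]/(size [:: (1, 0, 0) : int * int * int; (-1, 0, 0)]).
  apply: uniq_leq_size; first by rewrite (map_inj_uniq coords_inj) filter_uniq.
  move=> _ /mapP[x + ->]; rewrite mem_filter => /andP[/eqP x1 xX].
  by have [px qx] := pX _ xX; exact: isotropic_primitive_zeros qx x1.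
have d1 : 1 <= d by rewrite ler1n d3_gt0 // absz_gt0.
have -> : size X' = (size X0 + (size Xp + size Xn))%N.
  rewrite !size_filter; elim: X' {zX uX pX dX sub X0 Xp Xn h1 h2 h3} => //= x X' ->.
  by case: (ltgtP (x 1 0) 0) => _; lia.
rewrite !natrD; have h3' : (size X0)%:R <= 2 :> R by rewrite (ler_nat R _ 2).
nra.
Qed.

(** Induction on [|\det M|]: a descent step does not increase [W] times the squared gcd of minors
    over [|\det M|], and it replaces the determinant by a proper divisor, along which [d3] does not
    increase. *)
Lemma count_small_zeros (R : realType) (k W : R) (M : 'M[int]_3)
    (X : seq 'cV[int]_3) :
  1 <= k -> M^T = M -> \det M != 0 -> small_zeros W M X ->
  W * (gcd_minors2 M)%:R ^+ 2 <= k ^+ 3 * (`|\det M|)%:~R ->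
  (size X)%:R <= 162 * k * (d3 (absz (\det M)))%:R.
Proof.
move=> k1; have k0 : 0 <= k by lra.
have [n] := ubnP (absz (\det M)).
elim: n => // n IH in W M X *; rewrite ltnS => leDn sM dM zX hk.
have D0 := gcd_minors2_neq0 dM.
have [D1|nD1] := eqVneq (gcd_minors2 M) 1%N.
  by apply: count_coprime_minors zX _ => //; rewrite D1 expr1n mulr1 in hk.
pose p := pdiv (gcd_minors2 M).
have pp : prime p by rewrite pdiv_prime // ltn_neqAle eq_sym nD1 lt0n.
have pD : (p %| gcd_minors2 M)%N by exact: pdiv_dvd.
have p0 : p%:Z != 0 by rewrite -lt0n prime_gt0.
have pR : 1 < p%:R :> R by rewrite ltr1n prime_gt1.
have pA : absz p%:Z = p by [].
case eX : X => [|x0 Y0]; first by rewrite !mulr_ge0 //; lra.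
have W0 : 0 <= W.
  have [_ _ /(_ x0 x0 x0)] := zX; rewrite {1 2 3}eX mem_head.
  by move=> /(_ isT isT isT); apply: le_trans; rewrite ler0z.
rewrite -eX; clear eX Y0 x0.
have step (M' : 'M[int]_3) (W' : R) (X' : seq 'cV[int]_3) (e : nat) :
    (1 < e)%N -> \det M = e%:Z * \det M' -> M'^T = M' -> size X' = size X ->
    small_zeros W' M' X' ->
    W' * (gcd_minors2 M')%:R ^+ 2 * e%:R <= W * (gcd_minors2 M)%:R ^+ 2 ->
    (size X)%:R <= 162 * k * (d3 (absz (\det M)))%:R.
  move=> e1 eD sM' sX zX' hW; have e0 : (0 < e)%N by apply: ltnW.
  have dM' : \det M' != 0 by apply: contra dM => /eqP h; rewrite eD h mulr0.
  have eDn : absz (\det M) = (e * absz (\det M'))%N by rewrite eD abszM.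
  rewrite -sX; apply: le_trans (IH _ _ _ _ sM' dM' zX' _) _.
  - apply: leq_trans leDn; rewrite eDn -[X in (X < _)%N]mul1n ltn_pmul2r //.
    by rewrite absz_gt0.
  - have eR : 0 < e%:R :> R by rewrite ltr0n.
    rewrite -(ler_pM2r eR); apply: le_trans hW (le_trans hk _).
    by rewrite eD normrM intrM [leRHS]mulrAC mulrA.
  - rewrite ler_wpM2l ?mulr_ge0 // ler_nat d3_dvd_le ?absz_gt0 //.
    by rewrite eDn dvdn_mull.
(* If [p] misses some diagonal entry, the zeros lie in a sublattice of index [p], where [W] and the
   determinant both lose a factor [p]. *)
have [/existsP[i pM]|] := boolP [exists i, ~~ (p%:Z %| M i i)%Z].
  have [T [M' [dT congM hT]]] := descent_matrix pp pD sM pM.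
  have dT0 : \det T != 0 by rewrite dT.
  have dT2 : \det T ^+ 2 = p%:Z ^+ 2 by rewrite dT.
  have [|X' sX zX'] := small_zeros_transport p0 dT0 congM _ zX.
    by move=> x xX; apply: hT; case: zX => _ /(_ x xX)[].
  rewrite dT (ger0_norm (_ : 0 <= p%:Z)) // in zX'.
  apply: (step M' _ X' p) zX' _ => //.
  - exact: prime_gt1.
  - exact: det_congruence p0 dT2 congM.
  - apply/matrixP => a b; apply: (mulfI p0).
    have /(congr1 trmx)/matrixP/(_ a b) := congM.
    rewrite !trmx_mul trmxK sM mulmxA congM.
    by rewrite [(_ *: _)^T]linearZ !mxE => <-.
  - rewrite mulrAC divfK ?gt_eqF ?ltr0n ?prime_gt0 //.
    rewrite ler_wpM2l // ler_sqr ?nnegrE // ler_nat.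
    by rewrite dvdn_leq ?lt0n // (gcd_minors2_congruence p0 dT2 dM congM).
(* If [p] divides the diagonal, the minors [M i i * M j j - M i j ^+ 2] show that it divides [M].
   Dividing by [p] on the same lattice costs the determinant [p ^ 3], and the squared gcd of minors
   at least [p ^ 4]. *)
rewrite negb_exists => /forallP pM.
have [i j|M' eM] := @scale_of_dvd 3 3 p%:Z M.
  have := dvdz_minor2 i j i j pD; have sMe : M j i = M i j by rewrite -[in LHS]sM mxE.
  have /negbNE pi := pM i; rewrite sMe rpredBl; last exact: dvdz_mulr.
  by rewrite !dvdzE abszM /= Euclid_dvdM // orbb.
have congM : (1%:M)^T *m M *m 1%:M = p%:Z *: M' by rewrite trmx1 mul1mx mulmx1.
have [||X' sX zX'] := small_zeros_transport p0 _ congM _ zX.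
- by rewrite det1.
- by move=> x _; exists x; rewrite mul1mx.
rewrite det1 normr1 divr1 in zX'.
apply: (step M' _ X' (p ^ 3)%N) zX' _ => //.
- by rewrite -(exp1n 3) ltn_exp2r // prime_gt1.
- by rewrite eM detZ; congr (_ * _); rewrite -[RHS]natz natrX natz.
- apply/matrixP => a b; apply: (mulfI p0); have /matrixP/(_ b a) := eM.
  by rewrite -{1}sM mxE eM !mxE => ->.
have hp : (p ^ 2 * gcd_minors2 M' <= gcd_minors2 M)%N.
  by rewrite dvdn_leq ?lt0n // eM gcd_minors2Z.
rewrite -mulrA ler_wpM2l // -natrX -natrM -natrX ler_nat.
apply: leq_trans (_ : ((p ^ 2 * gcd_minors2 M') ^ 2 <= _)%N); last by rewrite leq_sqr.
by rewrite expnMn mulnC leq_mul2r -expnM leq_exp2l ?orbT // prime_gt1.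
Qed.

(** * From the box to the final bound *)

Lemma norm_det_triple_mx_le (R : realType) (B : 'I_3 -> R) (x y z : 'cV[int]_3) :
  (forall i, `|(x i ord0)%:~R| <= B i) -> (forall i, `|(y i ord0)%:~R| <= B i) ->
  (forall i, `|(z i ord0)%:~R| <= B i) ->
  `|\det (triple_mx x y z)|%:~R <= 6 * \prod_(i < 3) B i.
Proof.
move=> hx hy hz; rewrite det_triple_mx /tdet /coords /= intr_norm.
rewrite !big_ord_recl big_ord0 mulr1.
rewrite (_ : lift ord0 ord0 = 1); last exact: val_inj.
rewrite (_ : lift ord0 (lift ord0 ord0) = 2); last exact: val_inj.
rewrite !(intrD, intrM, mulrNz).
have t (a b c : int) : `|a%:~R| <= B 0 -> `|b%:~R| <= B 1 -> `|c%:~R| <= B 2 ->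
    `|a%:~R * (b%:~R * c%:~R)| <= B 0 * (B 1 * B 2).
  by move=> ha hb hc; rewrite !normrM !ler_pM ?mulr_ge0.
have := t _ _ _ (hx 0) (hy 1) (hz 2).
have := t _ _ _ (hx 0) (hz 1) (hy 2).
have := t _ _ _ (hy 0) (hx 1) (hz 2).
have := t _ _ _ (hz 0) (hx 1) (hy 2).
have := t _ _ _ (hy 0) (hz 1) (hx 2).
have := t _ _ _ (hz 0) (hy 1) (hx 2).
rewrite !ler_norml; set P := B 0 * _.
move=> /andP[a1 a2] /andP[b1 b2] /andP[c1 c2] /andP[d1 d2] /andP[e1 e2] /andP[f1 f2].
by apply/andP; split; lra.
Qed.

Theorem corollary2 (R : realType) (eps : R) (heps : 0 < eps) :
  exists C : R, 0 < C /\
    forall (q : 'cV[int]_3 -> int) (M : 'M[int]_3) (B : 'I_3 -> R),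
      is_matrix_of q M ->
      \det M != 0 ->
      (forall i, 0 < B i) ->
      let Delta := `|\det M|%N in
      let Delta0 := gcd_minors2 M in
      (#|` fset_set (primitive_zeros q B)|)%:R <=
        C * (1 + ((\prod_(i < 3) B i) * Delta0%:R ^+ 2 / Delta%:R)
                   `^ (3^-1 + eps))
          * (d3 Delta)%:R.
Proof.
(* With the [k] chosen below, [162 * k = 324 * (1 + E)], so any constant from 324 on will do. *)
exists 486; split=> // q M B [sM qM] dM B0; cbv zeta.
set Delta := absz _; set Delta0 := gcd_minors2 M; set V := \prod_(i < 3) B i.
have V0 : 0 <= V by apply: prodr_ge0 => i _; exact: ltW.
have DR : 0 < Delta%:R :> R by rewrite ltr0n absz_gt0.
pose Y := V * Delta0%:R ^+ 2 / Delta%:R.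
have Y0 : 0 <= Y by rewrite divr_ge0 ?mulr_ge0 ?exprn_ge0.
pose E := Y `^ (3^-1 + eps); have E0 : 0 <= E by exact: powR_ge0.
(* Chosen so that [6 * Y <= k ^+ 3]: the summand 2 suffices for [Y <= 1], and [2 * E] for [Y > 1],
   where [Y <= E ^+ 3] because three times the exponent exceeds 1. *)
pose k := 2 * (1 + E).
have k1 : 1 <= k by rewrite /k; lra.
have k3 : 6 * Y <= k ^+ 3.
  have [Y1|Y1] := leP Y 1.
    apply: (@le_trans _ _ (2 ^+ 3)); first by rewrite -natrX; lra.
    by rewrite ler_pXn2r ?nnegrE // /k; lra.
  have YE : Y <= E ^+ 3.
    rewrite -powR_mulrn // -powRrM.
    rewrite -[leLHS]powRr1 //; apply: ler_powR; first exact: ltW.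
    lra.
  apply: (@le_trans _ _ ((2 * E) ^+ 3)).
    rewrite exprMn -natrX; lra.
  by rewrite ler_pXn2r ?nnegrE // /k; lra.
set X := enum_fset (fset_set (primitive_zeros q B)).
have XP x : x \in X -> primitive_zeros q B x.
  by rewrite in_fset_set; [rewrite inE|exact: finite_primitive_zeros].
have zX : small_zeros (6 * V) M X.
  split; first exact: fset_uniq.
    by move=> x /XP[px qx _]; split => //; rewrite -qM.
  by move=> x y z /XP[_ _ hx] /XP[_ _ hy] /XP[_ _ hz]; exact: norm_det_triple_mx_le.
have hk : 6 * V * (gcd_minors2 M)%:R ^+ 2 <= k ^+ 3 * `|\det M|%:~R.
  have -> : `|\det M|%:~R = Delta%:R :> R by rewrite natr_absz.
  by rewrite -ler_pdivrMr // -[6 * V * _]mulrA -[6 * _ / _]mulrA.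
apply: le_trans (count_small_zeros k1 sM dM zX hk) _.
by rewrite -/Delta -/Y -/E ler_wpM2r // /k; lra.
Qed.
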